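(* Let $G=G_1\ast_A G_2$ be an amalgam of finite groups. Given $h_1,\ldots,h_n\in G$, there exists an algorithm which computes the index $[G:H]$ (possibly infinite) of the subgroup $H=\langle h_1,\ldots,h_n\rangle$ in $G$.
   Context: Setting: $G=G_1\ast_A G_2$ is a free product with amalgamation of finite groups $G_1=\langle X_1\mid R_1\rangle$ and $G_2=\langle X_2\mid R_2\rangle$, given by finite presentations with $X_1^{\pm}\cap X_2^{\pm}=\emptyset$, along a group $A=\langle Y\rangle$ with monomorphisms $\phi_i:A\to G_i$ ($i=1,2$), so $G=\langle X_1\cup X_2\mid R_1,R_2,\phi_1(a)=\phi_2(a)\ (a\in Y)\rangle$. All this data (including the Cayley graphs and relative Cayley graphs of $G_1,G_2$) is fixed and given. The input of the algorithm is the finite list $h_1,\ldots,h_n$, given as words over $(X_1\cup X_2)^{\pm}$. *)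

(* Defs.v *)
From HB Require Import structures.
From mathcomp Require Import all_boot.
From mathcomp Require Import boolp classical_sets functions cardinality.

Set Implicit Arguments.
Unset Strict Implicit.
Unset Printing Implicit Defensive.

Local Open Scope classical_set_scope.
Local Open Scope card_scope.
Local Open Scope quotient_scope.
Local Open Scope group_scope.

(* A letter (x, false) stands for x and (x, true) for x^-1. *)
Definition letter (X : Type) := (X * bool)%type.
Definition word (X : Type) := seq (letter X).

Definition letter_inv {X : Type} (a : letter X) : letter X := (a.1, ~~ a.2).
Definition word_inv {X : Type} (w : word X) : word X := rev (map letter_inv w).

Definition word_map {X X' : Type} (f : X -> X') (w : word X) : word X' :=
  [seq (f a.1, a.2) | a <- w].

Section Presentation.
Variables (X : choiceType) (R : seq (word X)).

Inductive pres_eq : word X -> word X -> Prop :=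
| pres_refl w : pres_eq w w
| pres_sym u v : pres_eq u v -> pres_eq v u
| pres_trans u v w : pres_eq u v -> pres_eq v w -> pres_eq u w
| pres_cat u u' v v' : pres_eq u u' -> pres_eq v v' ->
    pres_eq (u ++ v) (u' ++ v')
| pres_cancel a : pres_eq [:: a; letter_inv a] [::]
| pres_rel r : r \in R -> pres_eq r [::].

Definition pres_eqb : rel (word X) := fun u v => `[< pres_eq u v >].

Lemma pres_eqb_refl : reflexive pres_eqb.
Proof. by move=> w; apply/asboolP; apply: pres_refl. Qed.

Lemma pres_eqb_sym : symmetric pres_eqb.
Proof. by move=> u v; apply/asboolP/asboolP; apply: pres_sym. Qed.

Lemma pres_eqb_trans : transitive pres_eqb.
Proof.
move=> v u w /asboolP uv /asboolP vw.
by apply/asboolP; apply: pres_trans uv vw.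
Qed.

Canonical pres_equiv : equiv_rel (word X) :=
  EquivRel pres_eqb pres_eqb_refl pres_eqb_sym pres_eqb_trans.

(* The group < X | R >. *)
Definition presented := {eq_quot pres_equiv}.
HB.instance Definition _ := Choice.on presented.
HB.instance Definition _ := EqQuotient.on presented.

Definition ev (w : word X) : presented := \pi_presented w.

Lemma evP u v : ev u = ev v <-> pres_eq u v.
Proof.
rewrite /ev; split=> [/eqP|uv]; first by rewrite eqmodE => /asboolP.
by apply/eqP; rewrite eqmodE; apply/asboolP.
Qed.

Lemma ev_repr (x : presented) : ev (repr x) = x.
Proof. exact: reprK. Qed.

Definition pres_mul (x y : presented) : presented := ev (repr x ++ repr y).
Definition pres_one : presented := ev [::].
Definition pres_inv (x : presented) : presented := ev (word_inv (repr x)).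

Lemma word_inv_cat (u v : word X) :
  word_inv (u ++ v) = word_inv v ++ word_inv u.
Proof. by rewrite /word_inv map_cat rev_cat. Qed.

Lemma word_invK : involutive (@word_inv X).
Proof.
move=> w; rewrite /word_inv map_rev revK -map_comp -[RHS]map_id.
by apply: eq_map => -[x b] /=; rewrite /letter_inv /= negbK.
Qed.

Lemma pres_mulwV w : pres_eq (w ++ word_inv w) [::].
Proof.
elim: w => [|a w IHw]; first exact: pres_refl.
rewrite /word_inv map_cons rev_cons -cats1 cat_cons catA -cat1s.
apply: pres_trans (pres_cancel a); rewrite -[[:: a; _]]/([:: a] ++ [::] ++ _).
apply: pres_cat; first exact: pres_refl.
by apply: pres_cat => //; apply: pres_refl.
Qed.

Lemma pres_mulVw w : pres_eq (word_inv w ++ w) [::].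
Proof. by rewrite -{2}[w]word_invK; apply: pres_mulwV. Qed.

Lemma ev_cat u v : ev (u ++ v) = pres_mul (ev u) (ev v).
Proof.
by apply/evP/pres_cat; apply/evP; rewrite ev_repr.
Qed.

Lemma pres_mulA : associative pres_mul.
Proof.
by move=> x y z; rewrite -[x]ev_repr -[y]ev_repr -[z]ev_repr -!ev_cat catA.
Qed.

Lemma pres_mul1 : left_id pres_one pres_mul.
Proof. by move=> x; rewrite -[x]ev_repr -ev_cat. Qed.

Lemma pres_mulr1 : right_id pres_one pres_mul.
Proof. by move=> x; rewrite -[x]ev_repr -ev_cat cats0. Qed.

Lemma pres_mulV : left_inverse pres_one pres_inv pres_mul.
Proof.
move=> x; rewrite -{2}[x]ev_repr -ev_cat; apply/evP/pres_mulVw.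
Qed.

Lemma pres_mulrV : right_inverse pres_one pres_inv pres_mul.
Proof.
move=> x; rewrite -{1}[x]ev_repr -ev_cat; apply/evP/pres_mulwV.
Qed.

HB.instance Definition _ := isGroup.Build presented
  pres_mulA pres_mul1 pres_mulr1 pres_mulV pres_mulrV.

End Presentation.

Arguments presented {X} R.
Arguments ev {X} R w.

Section Subgroups.
Variable G : groupType.

Definition generated (S : set G) : set G :=
  smallest (fun K : set G => group_closed [pred x | x \in K]) S.

Definition right_cosets (H : set G) : set (set G) :=
  [set [set h * g | h in H] | g in setT].

(* [None] is the infinite index. *)
Definition has_index (H : set G) (k : option nat) : Prop :=
  if k is Some n then right_cosets H #= `I_n
  else infinite_set (right_cosets H).

End Subgroups.

Section Amalgam.
Variables (X1 X2 : choiceType) (R1 : seq (word X1)) (R2 : seq (word X2)).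
Variables (A : Type) (Y : seq A).
Variables (phi1 : A -> presented R1) (phi2 : A -> presented R2).

(* The alphabets are made disjoint by taking the sum type. The relator for
   [a] is phi1(a) phi2(a)^-1, spelt with arbitrarily chosen words
   representing phi1(a) and phi2(a). *)
Definition amalgam_relators : seq (word (X1 + X2)%type) :=
  map (word_map inl) R1 ++ map (word_map inr) R2 ++
  [seq word_map inl (repr (phi1 a)) ++ word_inv (word_map inr (repr (phi2 a)))
     | a <- Y].

Definition amalgam := presented amalgam_relators.
HB.instance Definition _ := Group.on amalgam.

End Amalgam.

(* Kleene's partial recursive functions: [murec n] is the type of programs
   for n-ary functions, and [computes f t y] says that f terminates on the
   input t with value y. *)
Inductive murec : nat -> Type :=
| MZero n : murec n
| MSucc : murec 1
| MProj n (i : 'I_n) : murec n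
| MComp n m (f : murec m) (g : 'I_m -> murec n) : murec n
| MPrec n (f : murec n) (g : murec n.+2) : murec n.+1
| MMin n (f : murec n.+1) : murec n.

Fixpoint computes n (f : murec n) : n.-tuple nat -> nat -> Prop :=
  match f in murec n return n.-tuple nat -> nat -> Prop with
  | MZero _ => fun _ y => y = 0
  | MSucc => fun t y => y = (thead t).+1
  | MProj _ i => fun t y => y = tnth t i
  | MComp _ m f g => fun t y =>
      exists u : m.-tuple nat,
        (forall i, computes (g i) t (tnth u i)) /\ computes f u y
  | MPrec _ f g => fun t y =>
      (* [r] lists the successive values of the recursion, whose variable is
         the first argument. *)
      exists r : nat -> nat,
        [/\ computes f [tuple of behead t] (r 0),
            forall i, i < thead t ->
              computes g [tuple of i :: r i :: behead t] (r i.+1)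
          & y = r (thead t)]
  | MMin _ f => fun t y =>
      computes f [tuple of y :: t] 0 /\
      forall i, i < y -> exists z, computes f [tuple of i :: t] z.+1
  end.

Lemma computes_fun n (f : murec n) t y z :
  computes f t y -> computes f t z -> y = z.
Proof.
elim: f t y z => {n}
  [n|| n i|n m f IHf g IHg|n f IHf g IHg|n f IHf] t y z /=; try by move=> -> ->.
- move=> [u [gu fu]] [v [gv fv]]; have uv : u = v.
    by apply: eq_from_tnth => i; apply: IHg (gu i) (gv i).
  by rewrite -uv in fv; apply: IHf fu fv.
- move=> [r [r0 rS ->]] [s [s0 sS ->]].
  suff rs i : i <= thead t -> r i = s i by apply: rs.
  elim: i => [_|i IHi lti]; first exact: IHf r0 s0.
  have := sS i lti; rewrite -(IHi (ltnW lti)).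
  exact: IHg (rS i lti).
- move=> [fy miny] [fz minz]; case: (ltngtP y z) => // [yz|zy].
    by have [w fw] := minz _ yz; have := IHf _ _ _ fy fw.
  by have [w fw] := miny _ zy; have := IHf _ _ _ fz fw.
Qed.

Definition code_letter (X : finType) (a : letter X) : nat :=
  (enum_rank a.1).*2 + a.2.

Definition code_word (X : finType) (w : word X) : nat :=
  CodeSeq.code (map (@code_letter X) w).

Definition code_words (X : finType) (hs : seq (word X)) : nat :=
  CodeSeq.code (map (@code_word X) hs).

(* A finite index is at least 1, so 0 is free to encode infinity. *)
Definition code_index (k : option nat) : nat := odflt 0 k.

(* Main.v *)
(* A subgroup H = <h1, ..., hn> of G = G1 *_A G2 is studied through its action on
   its right cosets.  Call precover a finite set V = V1 u V2, with an action of
   Gi on Vi, such that the two actions of A agree on the intersection of V1 and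
   V2, that V is connected, and that every hj reads a loop at a base point.

   By normal forms, V embeds into a transitive G-set whose base point is fixed
   by H, so H has index at least |V|.  If V1 or V2 is not V, and A is proper in
   both factors, this G-set is infinite and so is the index.  Conversely, the
   union of the factor orbits of the cosets visited while reading the hj is a
   precover whose size is bounded by a computable function of the hj.  It
   consists of all cosets when V1 = V2 = V, or when A is all of a factor.

   Thus the index is found by searching all partial tables of bounded size: it
   is infinite when A is proper in both factors and there is a precover with V1
   or V2 not equal to V, and otherwise it is the largest size of a precover with
   V1 = V2 = V. *)

Require Import Defs.
From mathcomp Require Import all_boot.
From mathcomp Require Import boolp classical_sets functions cardinality.

Set Implicit Arguments.
Unset Strict Implicit.
Unset Printing Implicit Defensive.

Local Open Scope classical_set_scope.
Local Open Scope card_scope.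

(** * Recursive functions *)

(* Expressions are functions of an environment [r : nat -> nat], so that
   binding a variable is shifting the environment; only the first [m]
   entries of [r] are inputs, the others being read as [0]. *)
Definition recursive m (F : (nat -> nat) -> nat) :=
  exists p : murec m, forall t : m.-tuple nat, computes p t (F (nth 0 t)).

Section Closure.
Implicit Types (m : nat) (F E Z : (nat -> nat) -> nat) (r : nat -> nat).
Implicit Types (P Q : (nat -> nat) -> bool).

Lemma recursive_ext m F E : (forall r, F r = E r) ->
  recursive m F -> recursive m E.
Proof. by move=> FE [p pF]; exists p => t; rewrite -FE. Qed.

Lemma recursive_var m i : i < m -> recursive m (fun r => r i).
Proof. by move=> im; exists (MProj (Ordinal im)) => t /=; rewrite (tnth_nth 0). Qed.

Lemma recursive_comp k m F (es : seq ((nat -> nat) -> nat)) :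
  recursive k F -> size es = k ->
  (forall j, j < k -> recursive m (nth (fun=> 0) es j)) ->
  recursive m (fun r => F (nth 0 [seq E r | E <- es])).
Proof.
move=> [p pF] sz rE.
have /boolp.choice [q qE] : forall j : 'I_k, exists q : murec m,
    forall t, computes q t (nth (fun=> 0) es j (nth 0 t)).
  by move=> j; apply: rE.
exists (MComp p q) => t /=.
have szt : size [seq E (nth 0 t) | E <- es] == k by rewrite size_map sz.
exists (Tuple szt); split; last exact: pF.
move=> i; rewrite (tnth_nth 0) (nth_map (fun=> 0)) ?sz //=.
Qed.

(** Entries beyond the inputs read as 0, so [h] has to send non-inputs to non-inputs as well as
    inputs to inputs; hence an equality of Booleans. *)
Lemma recursive_rename m k F (h : nat -> nat) :
  (forall i, (h i < k) = (i < m)) ->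
  recursive m F -> recursive k (fun r => F (fun i => r (h i))).
Proof.
move=> hP [p pF].
have hlt (i : 'I_m) : h i < k by rewrite hP.
exists (MComp p (fun i => MProj (Ordinal (hlt i)))) => t /=.
exists [tuple nth 0 t (h i) | i < m]; split.
  by move=> i; rewrite tnth_mktuple (tnth_nth 0).
suff -> : (fun i => nth 0 t (h i)) = nth 0 [tuple nth 0 t (h i) | i < m].
  exact: pF.
apply/funext => i; case: (ltnP i m) => im.
  by rewrite -[i]/(nat_of_ord (Ordinal im)) -tnth_nth tnth_mktuple.
by rewrite !nth_default ?size_tuple // leqNgt hP -leqNgt.
Qed.

Lemma recursive_shift m F :
  recursive m F -> recursive m.+1 (fun r => F (fun i => r i.+1)).
Proof. exact: recursive_rename. Qed.

Lemma recursive_const m n : recursive m (fun=> n).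
Proof.
elim: n => [|n [p pn]]; first by exists (MZero m).
exists (MComp MSucc (fun=> p)) => t /=; exists [tuple n].
by split=> // i; rewrite (ord1 i); apply: pn.
Qed.

Lemma recursive_succ m F : recursive m F -> recursive m (fun r => (F r).+1).
Proof.
move=> [p pF]; exists (MComp MSucc (fun=> p)) => t /=; exists [tuple F (nth 0 t)].
by split=> // i; rewrite (ord1 i); apply: pF.
Qed.

Lemma recursive_iteri m F Z (S : nat -> nat -> (nat -> nat) -> nat) :
  recursive m F -> recursive m Z ->
  recursive m.+2 (fun r => S (r 0) (r 1) (fun i => r i.+2)) ->
  recursive m (fun r => iteri (F r) (fun i x => S i x r) (Z r)).
Proof.
move=> rF [z zZ] [s sS].
(* [MPrec] recurses on its first argument, so it is fed the bound [F r] followed by the original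
   inputs. *)
pose es := F :: [seq (fun r => r i) | i <- iota 0 m].
suff rec : recursive m.+1 (fun r =>
    iteri (r 0) (fun i x => S i x (fun j => r j.+1)) (Z (fun j => r j.+1))).
  have szes : size es = m.+1 by rewrite /= size_map size_iota.
  have [|p pC] := recursive_comp rec szes (m := m).
    case=> [|j] jm //=; rewrite (nth_map 0) ?size_iota // nth_iota //.
    exact: recursive_var.
  exists p => t; have := pC t.
  rewrite /es /= -map_comp /comp /=.
  suff -> : nth 0 [seq nth 0 t x | x <- iota 0 m] = nth 0 t by [].
  rewrite -/(mkseq _ _) -[in X in mkseq _ X](size_tuple t) mkseq_nth //.
exists (MPrec z s) => t /=.
case/tupleP: t => n t /=.
exists (fun j => iteri j (fun i x => S i x (nth 0 t)) (Z (nth 0 t))).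
split=> [|i _|].
- have -> : [tuple of behead [tuple of n :: t]] = t by apply: val_inj.
  exact: zZ.
- by have := sS [tuple of i :: iteri i (fun i x => S i x (nth 0 t))
     (Z (nth 0 t)) :: behead [tuple of n :: t]].
- by rewrite theadE.
Qed.

Lemma recursive_least m F P :
  recursive m.+1 (fun r => P r) ->
  (forall r, P (fun i => if i is j.+1 then r j else F r)) ->
  (forall r i, i < F r -> ~~ P (fun k => if k is j.+1 then r j else i)) ->
  recursive m F.
Proof.
move=> rP PF minF.
(* Minimisation looks for a zero, so [P] is replaced by the function that is 0 where it holds and 1
   elsewhere. *)
have [p pP] : recursive m.+1 (fun r => iteri (P r) (fun _ _ => 0) 1).
  apply: (recursive_iteri (S := fun _ _ _ => 0)) => //; exact: recursive_const.
have env (t : m.-tuple nat) i :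
    nth 0 [tuple of i :: t] = fun k => if k is j.+1 then nth 0 t j else i.
  by apply/funext => -[|k].
exists (MMin p) => t /=; split.
  by have := pP [tuple of F (nth 0 t) :: t]; rewrite env PF.
move=> i iF; exists 0; have := pP [tuple of i :: t].
by rewrite env (negbTE (minF _ _ iF)).
Qed.

End Closure.

Ltac rec_hyp := match goal with
  | H : recursive ?m ?F |- recursive ?m _ => exact: H
  | H : recursive ?m ?F |- recursive ?m.+1 _ => exact: (recursive_shift H)
  | H : recursive ?m ?F |- recursive ?m.+2 _ =>
      exact: (recursive_shift (recursive_shift H))
  | H : recursive ?m ?F |- recursive ?m.+3 _ =>
      exact: (recursive_shift (recursive_shift (recursive_shift H)))
  end.
Ltac rec_leaf := first
  [ rec_hyp
  | exact: recursive_const | exact: recursive_var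
  | by apply: recursive_succ; exact: recursive_var ].

(** * Arithmetic, Boolean connectives, bounded quantifiers and bounded search *)

Section Arithmetic.
Implicit Types (m : nat) (F E Z : (nat -> nat) -> nat) (P Q : (nat -> nat) -> bool).

Lemma recursive_iter m F Z (S : nat -> (nat -> nat) -> nat) :
  recursive m F -> recursive m Z ->
  recursive m.+1 (fun r => S (r 0) (fun i => r i.+1)) ->
  recursive m (fun r => iter (F r) (fun x => S x r) (Z r)).
Proof.
move=> rF rZ rS.
apply: (@recursive_ext _ (fun r => iteri (F r) (fun _ x => S x r) (Z r))).
  by move=> r; elim: (F r) => //= n ->.
apply: (recursive_iteri (S := fun _ x => S x)) => //.
by have := recursive_shift rS.
Qed.

Lemma recursive_add m F E : recursive m F -> recursive m E ->
  recursive m (fun r => F r + E r).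
Proof.
move=> rF rE; apply: (@recursive_ext _ (fun r => iter (F r) succn (E r))).
  by move=> r; rewrite iter_succn addnC.
by apply: (recursive_iter (S := fun x _ => x.+1)); rec_leaf.
Qed.

Lemma recursive_pred m F : recursive m F -> recursive m (fun r => (F r).-1).
Proof.
move=> rF; apply: (@recursive_ext _ (fun r => iteri (F r) (fun i _ => i) 0)).
  by move=> r; case: (F r).
by apply: (recursive_iteri (S := fun i _ _ => i)); rec_leaf.
Qed.

Lemma recursive_sub m F E : recursive m F -> recursive m E ->
  recursive m (fun r => F r - E r).
Proof.
move=> rF rE; apply: (@recursive_ext _ (fun r => iter (E r) predn (F r))).
  by move=> r; elim: (E r) => [|n /= ->]; rewrite ?subn0 ?subnS.
apply: (recursive_iter (S := fun x _ => x.-1)) => //.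
by apply: recursive_pred; rec_leaf.
Qed.

Lemma recursive_mul m F E : recursive m F -> recursive m E ->
  recursive m (fun r => F r * E r).
Proof.
move=> rF rE; apply: (@recursive_ext _ (fun r => iter (F r) (addn (E r)) 0)).
  by move=> r; rewrite iter_addn addn0 mulnC.
apply: (recursive_iter (S := fun x r => E r + x)); try rec_leaf.
by apply: recursive_add; rec_leaf.
Qed.

Lemma recursive_if m P F E : recursive m (fun r => P r) ->
  recursive m F -> recursive m E -> recursive m (fun r => if P r then F r else E r).
Proof.
move=> rP rF rE.
(* A Boolean read as a number counts zero or one iteration. *)
apply: (@recursive_ext _ (fun r => iter (P r) (fun=> F r) (E r))).
  by move=> r; case: (P r).
by apply: (recursive_iter (S := fun _ r => F r)); rec_leaf.
Qed.

Lemma recursive_eq0 m F : recursive m F -> recursive m (fun r => F r == 0).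
Proof.
move=> rF; apply: (@recursive_ext _ (fun r => 1 - F r)); first by move=> r; case: (F r).
by apply: recursive_sub; rec_leaf.
Qed.

Lemma recursive_leq m F E : recursive m F -> recursive m E ->
  recursive m (fun r => F r <= E r).
Proof. by move=> rF rE; apply: recursive_eq0; apply: recursive_sub. Qed.

Lemma recursive_negb m P : recursive m (fun r => P r) -> recursive m (fun r => ~~ P r).
Proof.
move=> rP; apply: (@recursive_ext _ (fun r => (P r : nat) == 0)).
  by move=> r; case: (P r).
exact: recursive_eq0.
Qed.

Lemma recursive_andb m P Q : recursive m (fun r => P r) ->
  recursive m (fun r => Q r) -> recursive m (fun r => P r && Q r).
Proof.
move=> rP rQ; apply: (@recursive_ext _ (fun r => P r * Q r)); last exact: recursive_mul.
by move=> r; rewrite mulnb.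
Qed.

Lemma recursive_orb m P Q : recursive m (fun r => P r) ->
  recursive m (fun r => Q r) -> recursive m (fun r => P r || Q r).
Proof.
move=> rP rQ; apply: (@recursive_ext _ (fun r => ~~ (~~ P r && ~~ Q r))).
  by move=> r; rewrite negb_and !negbK.
by apply: recursive_negb; apply: recursive_andb; apply: recursive_negb.
Qed.

Lemma recursive_implyb m P Q : recursive m (fun r => P r) ->
  recursive m (fun r => Q r) -> recursive m (fun r => P r ==> Q r).
Proof.
move=> rP rQ; apply: (@recursive_ext _ (fun r => ~~ P r || Q r)).
  by move=> r; rewrite implybE.
by apply: recursive_orb; first apply: recursive_negb.
Qed.

Lemma recursive_eqn m F E : recursive m F -> recursive m E ->
  recursive m (fun r => F r == E r).
Proof.
move=> rF rE; apply: (@recursive_ext _ (fun r => (F r <= E r) && (E r <= F r))).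
  by move=> r; rewrite -eqn_leq.
by apply: recursive_andb; apply: recursive_leq.
Qed.

Lemma recursive_exp m F E : recursive m F -> recursive m E ->
  recursive m (fun r => F r ^ E r).
Proof.
move=> rF rE; apply: (@recursive_ext _ (fun r => iter (E r) (muln (F r)) 1)).
  by move=> r; rewrite iter_muln muln1.
apply: (recursive_iter (S := fun x r => F r * x)); try rec_leaf.
by apply: recursive_mul; rec_leaf.
Qed.

(** A counter reset on reaching the divisor gives the remainder; for divisor 0 it is never reset, in
    accordance with [n %% 0 = n]. *)
Lemma recursive_modn m F E : recursive m F -> recursive m E ->
  recursive m (fun r => F r %% E r).
Proof.
move=> rF rE; apply: (@recursive_ext _ (fun r =>
    iter (F r) (fun x => if x.+1 == E r then 0 else x.+1) 0)).
  move=> r; elim: (F r) => [|n /= ->]; first by rewrite mod0n.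
  rewrite modnS; case: (E r) => [|d]; first by rewrite dvd0n modn0.
  rewrite /dvdn -[n.+1]addn1 -modnDml addn1.
  have := ltn_pmod n (ltn0Sn d); rewrite leq_eqVlt => /orP[/eqP->|lt].
    by rewrite modnn !eqxx.
  by rewrite (modn_small lt) (ltn_eqF lt).
apply: (recursive_iter (S := fun x r => if x.+1 == E r then 0 else x.+1)); try rec_leaf.
by apply: recursive_if; first apply: recursive_eqn; rec_leaf.
Qed.

(** For a nonzero divisor the quotient counts its multiples among [1, ..., F r]. *)
Lemma recursive_divn m F E : recursive m F -> recursive m E ->
  recursive m (fun r => F r %/ E r).
Proof.
move=> rF rE; apply: (@recursive_ext _ (fun r => if E r == 0 then 0 else
    iteri (F r) (fun i x => (i.+1 %% E r == 0) + x) 0)).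
  move=> r; case: eqP => [->|/eqP]; first by rewrite divn0.
  rewrite -lt0n => E0; elim: (F r) => [|n /= ->]; first by rewrite div0n.
  by rewrite divnS.
apply: recursive_if; [exact: recursive_eq0 | rec_leaf |].
apply: (recursive_iteri (S := fun i x r => (i.+1 %% E r == 0) + x)); try rec_leaf.
apply: recursive_add; last rec_leaf.
by apply: recursive_eq0; apply: recursive_modn; rec_leaf.
Qed.

Lemma recursive_all_iota m F (P : nat -> (nat -> nat) -> bool) :
  recursive m F -> recursive m.+1 (fun r => P (r 0) (fun i => r i.+1)) ->
  recursive m (fun r => all (fun v => P v r) (iota 0 (F r))).
Proof.
move=> rF rP; apply: (@recursive_ext _ (fun r =>
    iteri (F r) (fun i x => (0 < x) && P i r) true)).
  move=> r; elim: (F r) => // n IHn.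
  rewrite -[in RHS]addn1 iotaD all_cat add0n /= IHn lt0b andbT; by [].
apply: (recursive_iteri (S := fun i x r => (0 < x) && P i r)); try rec_leaf.
apply: recursive_andb; first by apply: recursive_leq; rec_leaf.
(* The renaming skips position 1, which holds the accumulator. *)
by apply: (@recursive_rename _ _ _ (fun i => if i is j.+1 then j.+2 else 0)) rP => -[].
Qed.

Lemma recursive_has_iota m F (P : nat -> (nat -> nat) -> bool) :
  recursive m F -> recursive m.+1 (fun r => P (r 0) (fun i => r i.+1)) ->
  recursive m (fun r => has (fun v => P v r) (iota 0 (F r))).
Proof.
move=> rF rP; apply: (@recursive_ext _ (fun r =>
    ~~ all (fun v => ~~ P v r) (iota 0 (F r)))).
  by move=> r; rewrite all_predC negbK.
apply/recursive_negb/(recursive_all_iota (P := fun v r => ~~ P v r)) => //.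
exact: recursive_negb.
Qed.

Lemma recursive_all m (T : Type) (s : seq T) (P : T -> (nat -> nat) -> bool) :
  (forall x, recursive m (fun r => P x r)) ->
  recursive m (fun r => all (fun x => P x r) s).
Proof.
move=> rP; elim: s => [|x s IHs] /=; first exact: recursive_const.
exact: recursive_andb.
Qed.

(** [find] returns the bound when nothing is found, so it is the least [v] that satisfies [P] or
    equals the bound. *)
Lemma recursive_find_iota m F (P : nat -> (nat -> nat) -> bool) :
  recursive m F -> recursive m.+1 (fun r => P (r 0) (fun i => r i.+1)) ->
  recursive m (fun r => find (fun v => P v r) (iota 0 (F r))).
Proof.
move=> rF rP.
apply: (@recursive_least _ _ (fun r =>
    P (r 0) (fun i => r i.+1) || (r 0 == F (fun i => r i.+1)))).
- by apply: recursive_orb => //; apply: recursive_eqn; rec_leaf.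
- move=> r; have := find_size (fun v => P v r) (iota 0 (F r)); rewrite size_iota.
  rewrite leq_eqVlt => /orP[/= ->|lt /=]; first by rewrite orbT.
  have /(nth_find 0) : has (fun v => P v r) (iota 0 (F r)).
    by rewrite has_find size_iota.
  by rewrite nth_iota // => ->.
- move=> r i lti; have ltF := leq_trans lti (find_size _ _).
  rewrite size_iota in ltF; have := before_find 0 lti.
  by rewrite nth_iota // add0n => ->; rewrite ltn_eqF.
Qed.

Lemma recursive_lookup m (s : seq nat) F :
  recursive m F -> recursive m (fun r => nth 0 s (F r)).
Proof.
move=> rF; elim: s F rF => [|x s IHs] F rF.
  apply: (@recursive_ext _ (fun=> 0)); last exact: recursive_const.
  by move=> r; rewrite nth_nil.
apply: (@recursive_ext _ (fun r => if F r == 0 then x else nth 0 s (F r).-1)).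
  by move=> r; case: (F r).
apply: recursive_if; [exact: recursive_eq0 | rec_leaf |].
by apply: IHs; apply: recursive_pred.
Qed.
End Arithmetic.

(** * Decoding lists of numbers arithmetically *)

Section Lists.

(** [CodeSeq.code (n :: s)] is [2 ^ n] times the odd number [(CodeSeq.code s).*2.+1]. So the head is
    the 2-adic valuation, and dividing by one more power of 2 leaves the code of the tail. *)
Definition hd_code c := find (fun i => ~~ (2 ^ i.+1 %| c)) (iota 0 c).
Definition tl_code c := c %/ 2 ^ (hd_code c).+1.
(** A list is no longer than its code, so [c] rounds suffice; an exhausted tail has code 0, and then
    the accumulator is kept. *)
Definition foldl_code (g : nat -> nat -> nat) x0 c :=
  iteri c (fun j x =>
    if iter j tl_code c == 0 then x else g x (hd_code (iter j tl_code c))) x0.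

Lemma find_geq_iota n k : n <= k -> find (fun i => n <= i) (iota 0 k) = n.
Proof.
move=> nk; have -> : iota 0 k = iota 0 n ++ iota n (k - n).
  by have := iotaD 0 n (k - n); rewrite subnKC.
rewrite find_cat size_iota.
have -> : has (fun i => n <= i) (iota 0 n) = false.
  by apply/hasPn => i; rewrite mem_iota -ltnNge.
by case: (k - n) => [|j] /=; rewrite ?leqnn addn0.
Qed.

Lemma hd_codeE n s : hd_code (CodeSeq.code (n :: s)) = n.
Proof.
rewrite /hd_code /=; set q := _.*2.+1; set c := _ * q.
have dvd i : (2 ^ i.+1 %| c) = (i < n).
  have q2 : coprime (2 ^ i.+1) q by rewrite coprimeXl // coprime2n /= odd_double.
  by rewrite Gauss_dvdl // dvdn_Pexp2l.
have nc : n < c by rewrite (leq_trans (ltn_expl n (ltnSn 1))) // leq_pmulr.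
rewrite (eq_find (a2 := fun i => n <= i)); last by move=> i; rewrite dvd -leqNgt.
by rewrite find_geq_iota // ltnW.
Qed.

Lemma tl_codeE n s : tl_code (CodeSeq.code (n :: s)) = CodeSeq.code s.
Proof.
rewrite /tl_code hd_codeE /= expnSr divnMA mulKn ?expn_gt0 //.
by rewrite divn2 /= uphalf_double.
Qed.

Lemma tl_code0 : tl_code 0 = 0. Proof. exact: div0n. Qed.

Lemma iter_tl_code j s : iter j tl_code (CodeSeq.code s) = CodeSeq.code (drop j s).
Proof.
elim: j s => [|j IHj] s; first by rewrite drop0.
rewrite iterSr; case: s => [|n s]; last by rewrite tl_codeE IHj.
by elim: j {IHj} => //= j ->; rewrite tl_code0.
Qed.

Lemma code_eq0 s : (CodeSeq.code s == 0) = (s == [::]).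
Proof. by case: s => //= n s; rewrite muln_eq0 expn_eq0. Qed.

(* This makes the code itself a bound on the total length of the words. *)
Lemma sumn_code s : sumn (map succn s) <= CodeSeq.code s.
Proof.
elim: s => //= n s IHs; set c := CodeSeq.code s in IHs *.
rewrite mulnS; apply: leq_add; first exact: ltn_expl.
rewrite (leq_trans IHs) // (@leq_trans c.*2) ?leq_pmull ?expn_gt0 //.
by rewrite -addnn leq_addr.
Qed.

Lemma size_code s : size s <= CodeSeq.code s.
Proof.
apply: leq_trans (sumn_code s); elim: s => //= n s IHs.
by rewrite addSn ltnS (leq_trans IHs) ?leq_addl.
Qed.

Lemma foldl_codeE g x0 s : foldl_code g x0 (CodeSeq.code s) = foldl g x0 s.
Proof.
rewrite -[in RHS](take_oversize (size_code s)) /foldl_code.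
elim: {1 4}(CodeSeq.code s) => [|j IHj] /=; first by rewrite take0.
rewrite iter_tl_code code_eq0 IHj.
case: (ltnP j (size s)) => js.
  by rewrite (take_nth 0) // (drop_nth 0) //= foldl_rcons hd_codeE.
by rewrite drop_oversize //= !take_oversize // ltnW.
Qed.

Lemma recursive_hd_code m F : recursive m F -> recursive m (fun r => hd_code (F r)).
Proof.
move=> rF; apply: (recursive_find_iota
  (P := fun i r => ~~ (2 ^ i.+1 %| F r))) => //.
apply: recursive_negb; apply: recursive_eq0; apply: recursive_modn; first rec_leaf.
by apply: recursive_exp; rec_leaf.
Qed.

Lemma recursive_tl_code m F : recursive m F -> recursive m (fun r => tl_code (F r)).
Proof.
move=> rF; apply: recursive_divn => //; apply: recursive_exp; first rec_leaf.
by apply/recursive_succ/recursive_hd_code.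
Qed.

Lemma recursive_foldl_code m F Z (S : nat -> nat -> (nat -> nat) -> nat) :
  recursive m F -> recursive m Z ->
  recursive m.+2 (fun r => S (r 0) (r 1) (fun i => r i.+2)) ->
  recursive m (fun r => foldl_code (fun x n => S x n r) (Z r) (F r)).
Proof.
move=> rF rZ rS; apply: (recursive_iteri (S := fun j x r =>
  if iter j tl_code (F r) == 0 then x else S x (hd_code (iter j tl_code (F r))) r)) => //.
have rtl : recursive m.+2 (fun r => iter (r 0) tl_code (F (fun i => r i.+2))).
  apply: (recursive_iter (S := fun x _ => tl_code x)); try rec_leaf.
  by apply: recursive_tl_code; rec_leaf.
apply: recursive_if; [exact: recursive_eq0 | rec_leaf |].
pose E := fun r => hd_code (iter (r 0) tl_code (F (fun i => r i.+2))).
have rE : recursive m.+2 E by exact: recursive_hd_code.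
(* One iteration starting from [E r] substitutes the decoded head for a variable of [S]. *)
apply: (@recursive_ext _ (fun r => iter 1 (fun n => S (r 1) n (fun i => r i.+2)) (E r))) => //.
apply: (recursive_iter (S := fun n r => S (r 1) n (fun i => r i.+2))); try rec_leaf.
(* The environment now lists the head, the loop counter, the accumulator and the inputs; [S] takes
   the accumulator, the head and the inputs. *)
pose h i := match i with 0 => 2 | 1 => 0 | j.+2 => j.+3 end.
by apply: (@recursive_rename _ _ _ h) rS => -[|[]].
Qed.

End Lists.

Definition digit b k c := iter k (fun c => c %/ b) c %% b.

Lemma recursive_digit m B K C : recursive m B -> recursive m K -> recursive m C ->
  recursive m (fun r => digit (B r) (K r) (C r)).
Proof.
move=> rB rK rC; apply: recursive_modn => //.
apply: (recursive_iter (S := fun c r => c %/ B r)) => //.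
by apply: recursive_divn; rec_leaf.
Qed.

(** The first value becomes the lowest digit, the others the digits of the quotient by [b]. A search
    of all codes below [b ^ k] therefore meets every table. *)
Lemma digitsP b k (F : nat -> nat) : (forall i, i < k -> F i < b) ->
  exists2 c, c < b ^ k & forall i, i < k -> digit b i c = F i.
Proof.
elim: k F => [|k IHk] F Fb; first by exists 0; rewrite // expn0.
have b0 : 0 < b by apply: leq_ltn_trans (Fb 0 _).
have [i ik|c cb cF] := IHk (fun i => F i.+1); first exact: Fb.
exists (c * b + F 0); first by rewrite expnSr -ltn_divLR // divnMDl // divn_small ?addn0 // Fb.
case=> [|i] ik; rewrite /digit ?iterSr /=; first by rewrite modnMDl modn_small ?Fb.
by rewrite divnMDl // divn_small ?Fb // addn0; apply: cF.
Qed.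

Local Open Scope group_scope.

(** * The completion of a precover *)

Lemma morph_one (A G : groupType) (f : A -> G) :
  {morph f : x y / x * y} -> f 1 = 1.
Proof. by move=> fM; apply: (mulIg (f 1)); rewrite -fM !mul1g. Qed.

Lemma morph_inv (A G : groupType) (f : A -> G) :
  {morph f : x y / x * y} -> {morph f : x / x^-1}.
Proof.
by move=> fM x; apply: (mulIg (f x)); rewrite -fM !mulVg morph_one.
Qed.

Lemma transversal_exists (A G : groupType) (phi : A -> G) :
  {morph phi : x y / x * y} -> injective phi ->
  exists ta : (G -> G) * (G -> A),
    [/\ forall g, phi (ta.2 g) * ta.1 g = g,
        forall a g, ta.1 (phi a * g) = ta.1 g & ta.1 1 = 1].
Proof.
move=> phiM inj.
have [phi1 phiV] := (morph_one phiM, morph_inv phiM).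
pose K g := [set h | exists a, h = phi a * g].
(* The representative is chosen from the set [K g], so it depends on the coset alone; the image of
   [phi] gets the representative 1. *)
pose t g := if 1 \in K g then 1 else xget 1 (K g).
have KM a g : K (phi a * g) = K g.
  apply/seteqP; split=> h [b ->]; first by exists (b * a); rewrite phiM mulgA.
  by exists (b / a); rewrite phiM phiV -mulgA mulKg.
have tM a g : t (phi a * g) = t g by rewrite /t KM.
have Kt g : K g (t g).
  rewrite /t; case: ifPn => [/set_mem//|_].
  by apply: (@xgetPex _ 1 (K g)); exists g; exists 1; rewrite phi1 mul1g.
have /boolp.choice[al alP] g : exists a, phi a * t g = g.
  by have [a ->] := Kt g; exists a^-1; rewrite phiV mulKg.
exists (t, al); split=> //=.
by rewrite /t ifT //; apply/mem_set; exists 1; rewrite phi1 mul1g.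
Qed.

Section Completion.
Variables (Gs : bool -> groupType) (A : groupType).
Variable phi : forall i, A -> Gs i.
Hypothesis phiM : forall i, {morph @phi i : x y / x * y}.
Hypothesis phi_inj : forall i, injective (phi i).
Variables (V : Type) (D : bool -> V -> bool) (op : forall i, V -> Gs i -> V).
Arguments op : clear implicits.
Arguments phi : clear implicits.
Let phi_1 i : phi i 1 = 1 := morph_one (@phiM i).
Let phiV i a : phi i a^-1 = (phi i a)^-1 := morph_inv (@phiM i) a.
Hypothesis op1 : forall i v, D i v -> op i v 1 = v.
Hypothesis opM : forall i v g h, D i v -> op i (op i v g) h = op i v (g * h).
Hypothesis Dop : forall i v g, D i v -> D i (op i v g).
Hypothesis op_phi : forall v a, D true v -> D false v ->
  op true v (phi true a) = op false v (phi false a).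

Let inV v := D true v || D false v.

(** [A] acts through the factor [true] where that one acts, and otherwise through [false]; by
    [op_phi] any factor acting at [v] gives the same result. *)
Definition opA v a := op (D true v) v (phi (D true v) a).

Lemma opAE i v a : D i v -> opA v a = op i v (phi i a).
Proof. by rewrite /opA; case: i; case Dt: (D true v) => // Df; rewrite op_phi. Qed.

Lemma inVE v : inV v -> exists i, D i v.
Proof. by case/orP => Di; [exists true|exists false]. Qed.

Lemma inV_D i v : D i v -> inV v.
Proof. by rewrite /inV; case: i => ->; rewrite ?orbT. Qed.

Lemma inV_opA v a : inV v -> inV (opA v a).
Proof. by case/inVE => i Di; rewrite (opAE _ Di) (inV_D (Dop _ Di)). Qed.

Lemma opA1 v : inV v -> opA v 1 = v.
Proof. by case/inVE => i Di; rewrite (opAE _ Di) phi_1 op1. Qed.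

Lemma opAM v a b : inV v -> opA (opA v a) b = opA v (a * b).
Proof.
case/inVE => i Di; rewrite !(opAE _ Di) (opAE _ (Dop _ Di)).
by rewrite opM // phiM.
Qed.

Lemma D_opA i v a : inV v -> D i (opA v a) = D i v.
Proof.
move=> vV; apply/idP/idP => Di; last by rewrite (opAE _ Di) Dop.
by rewrite -(opA1 vV) -(mulgV a) -opAM // (opAE _ Di) Dop.
Qed.

Definition tau_alpha i := projT1 (cid (transversal_exists (@phiM i) (@phi_inj i))).
Definition tau i : Gs i -> Gs i := (tau_alpha i).1.
Definition alpha i : Gs i -> A := (tau_alpha i).2.
Arguments tau : clear implicits.
Arguments alpha : clear implicits.

Lemma alpha_tau i g : phi i (alpha i g) * tau i g = g.
Proof. by rewrite /alpha /tau /tau_alpha; case: cid => ta []. Qed.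
Lemma tauM i a g : tau i (phi i a * g) = tau i g.
Proof. by rewrite /alpha /tau /tau_alpha; case: cid => ta []. Qed.
Lemma tau1 i : tau i 1 = 1.
Proof. by rewrite /alpha /tau /tau_alpha; case: cid => ta []. Qed.
Lemma alphaM i a g : alpha i (phi i a * g) = a * alpha i g.
Proof.
apply: (@phi_inj i); apply: (mulIg (tau i g)).
by rewrite -(tauM a g) alpha_tau phiM -mulgA tauM alpha_tau.
Qed.
Lemma tauK i g : tau i (tau i g) = tau i g.
Proof. by rewrite -{2}(alpha_tau g) tauM. Qed.
Lemma alpha1 i : alpha i 1 = 1.
Proof. by apply: (@phi_inj i); have := alpha_tau (1 : Gs i); rewrite tau1 mulg1 phi_1. Qed.
Lemma tau_phi i a : tau i (phi i a) = 1.
Proof. by rewrite -[phi i a]mulg1 tauM tau1. Qed.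
Lemma alpha_phi i a : alpha i (phi i a) = a.
Proof. by rewrite -[phi i a]mulg1 alphaM alpha1 mulg1. Qed.
Lemma alpha_tau_id i t : tau i t = t -> alpha i t = 1.
Proof.
move=> tt; apply: (@phi_inj i); apply: (mulIg t).
by rewrite -{2}tt alpha_tau phi_1 mul1g.
Qed.
Lemma tau_eq1 i g : tau i g = 1 -> g = phi i (alpha i g).
Proof. by move=> t1; rewrite -{1}(alpha_tau g) t1 mulg1. Qed.

(* [Syl (... (Syl (Base v) t1) ...) tn] is the formal point [v t1 ... tn]. *)
Inductive nform := Base of V | Syl i of nform & Gs i.

(** A syllable of the factor [i] can be appended to [x] without merging: either the last syllable
    comes from the other factor, or [x] is a base point outside the domain of [i]. *)
Definition opens i x := if x is Syl j _ _ then j != i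
                       else if x is Base v then ~~ D i v else false.

Fixpoint normal x := match x with
  | Base v => inV v
  | Syl i y t => [&& normal y, opens i y, tau i t == t & t != 1]
  end.

(** An element of [A] on the right is carried leftwards through the syllables by splitting
    [t * phi i a] into its part in [A] and its representative, until it reaches the base point. *)
Fixpoint pA x a := match x with
  | Base v => Base (opA v a)
  | Syl i y t => Syl (pA y (alpha i (t * phi i a))) (tau i (t * phi i a))
  end.

(* [x g] for a point [x] on which the factor [i] does not act yet: [x] is moved
   by the part of [g] in [A], and the transversal part is appended. *)
Definition push i x (g : Gs i) :=
  if tau i g == 1 then pA x (alpha i g) else Syl (pA x (alpha i g)) (tau i g).

(** Matching on both Booleans identifies the types of [g] and [t] when the last syllable is from the
    acting factor; then [g] is merged into it. *)
Definition pact i x : Gs i -> nform :=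
  match x with
  | Base v => fun g => if D i v then Base (op i v g) else push (Base v) g
  | Syl j y t =>
      match i, j return Gs i -> Gs j -> nform with
      | true, true => fun g t => push y (t * g)
      | false, false => fun g t => push y (t * g)
      | _, _ => fun g _ => push x g
      end^~ t
  end.
Arguments pact i x : clear implicits.

Lemma pact_open i x g : opens i x -> pact i x g = push x g.
Proof. by case: i g => g; case: x => [v|[] y t] //= /negbTE ->. Qed.

Lemma pact_syl i y t g : pact i (Syl y t) g = push y (t * g).
Proof. by case: i t g. Qed.

Lemma not_opens i x : normal x -> ~~ opens i x ->
  (exists2 v, x = Base v & D i v) \/
  (exists y (t : Gs i), [/\ x = Syl y t, normal y, opens i y, tau i t = t & t != 1]).
Proof.
case: x => [v|j y t] /=; first by move=> _ /negPn Di; left; exists v.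
move=> /and4P[ny oy /eqP tt t1] /negPn/eqP ji; right.
by case: _ / ji; exists y, t.
Qed.

Lemma opens_pA i x a : normal x -> opens i (pA x a) = opens i x.
Proof. by case: x => [v|j y t] //= vV; rewrite D_opA. Qed.

Lemma normal_pA x a : normal x -> normal (pA x a).
Proof.
elim: x a => [v|i y IHy t] a /=; first exact: inV_opA.
case/and4P=> ny oy /eqP tt t1; rewrite IHy // opens_pA // oy tauK eqxx /=.
(* A trivial representative would put [t * phi i a], hence [t], into the image of [A], forcing
   [t = tau i t = 1]. *)
apply: contra t1 => /eqP /tau_eq1 e; rewrite -tt.
by rewrite -(mulgK (phi i a) t) e -phiV -phiM tau_phi.
Qed.

Lemma pA1 x : normal x -> pA x 1 = x.
Proof.
elim: x => [v|i y IHy t] /=; first by move=> /opA1 ->.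
move=> /and4P[ny _ /eqP tt _].
by rewrite phi_1 mulg1 tt (alpha_tau_id tt) IHy.
Qed.

Lemma pAM x a b : normal x -> pA (pA x a) b = pA x (a * b).
Proof.
elim: x a b => [v|i y IHy t] a b /=; first by move=> vV; rewrite opAM.
case/and4P=> ny _ _ _; rewrite IHy // phiM mulgA.
by rewrite -[X in _ = Syl (pA _ (alpha _ (X * _))) (tau _ (X * _))]alpha_tau -mulgA tauM alphaM.
Qed.

Lemma push_pA i x a g : normal x -> @push i (pA x a) g = push x (phi i a * g).
Proof. by move=> nx; rewrite /push tauM alphaM pAM. Qed.

Lemma normal_push i x g : normal x -> opens i x -> normal (@push i x g).
Proof.
move=> nx ox; rewrite /push; case: ifPn => t1; first exact: normal_pA.
by rewrite /= normal_pA // opens_pA // ox tauK eqxx.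
Qed.

(** If [g] is in the image of [A], the pushed point is still open and [h] is pushed in turn;
    otherwise it ends in a syllable into which [h] is merged. *)
Lemma pact_push i x g h : normal x -> opens i x ->
  pact i (push x g) h = push x (g * h).
Proof.
move=> nx ox; rewrite {1}/push; case: ifPn => [/eqP/tau_eq1 {2}->|t1].
  by rewrite pact_open ?opens_pA // push_pA.
by rewrite pact_syl push_pA // mulgA alpha_tau.
Qed.

Lemma normal_pact i x g : normal x -> normal (pact i x g).
Proof.
move=> nx; have [ox|/(not_opens nx)[[v -> Di]|[y [t [-> ny oy _ _]]]]] :=
  boolP (opens i x).
- by rewrite pact_open // normal_push.
- by rewrite /= Di /= (inV_D (Dop _ Di)).
- by rewrite pact_syl normal_push.
Qed.

Lemma pactM i x g h : normal x -> pact i (pact i x g) h = pact i x (g * h).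
Proof.
move=> nx; have [ox|/(not_opens nx)[[v -> Di]|[y [t [-> ny oy _ _]]]]] :=
  boolP (opens i x).
- by rewrite !(@pact_open _ x) // pact_push.
- by rewrite /= Di /= Dop // opM.
- by rewrite !pact_syl pact_push // mulgA.
Qed.

(** [pA] is independent of the factor, so this makes the two actions agree on [A], as the amalgam
    demands. *)
Lemma pact_phi i x a : normal x -> pact i x (phi i a) = pA x a.
Proof.
move=> nx; have [ox|/(not_opens nx)[[v -> Di]|[y [t [-> ny oy tt t1]]]]] :=
  boolP (opens i x).
- by rewrite pact_open // /push tau_phi alpha_phi eqxx.
- by rewrite /= Di (opAE _ Di).
- rewrite pact_syl /push ifN //=.
  apply: contra t1 => /eqP /tau_eq1 e; rewrite -tt.
  by rewrite -(mulgK (phi i a) t) e -phiV -phiM tau_phi.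
Qed.

Lemma pact1 i x : normal x -> pact i x 1 = x.
Proof. by move=> nx; rewrite -(phi_1 i) pact_phi // pA1. Qed.

Lemma pact_base i v g : D i v -> pact i (Base v) g = Base (op i v g).
Proof. by move=> /= ->. Qed.

(* Applying alternately elements outside the amalgamated subgroup, starting
   on a side which does not act on [v], keeps lengthening the normal form. *)
Lemma infinite_orbit (O : set nform) i v :
  (forall j, exists g, forall a, phi j a <> g) ->
  inV v -> ~~ D i v -> O (Base v) -> (forall j x g, O x -> O (pact j x g)) ->
  infinite_set O.
Proof.
move=> nsurj vV nD Ov Oact.
pose len := fix len x := if x is Syl _ y _ then (len y).+1 else 0%N.
have steps n : exists x j, [/\ O x, normal x, opens j x & len x = n].
  elim: n => [|n [x [j [Ox nx ox lx]]]]; first by exists (Base v), i.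
  have [g gP] := nsurj j.
  (* An element outside the image of [A] has a nontrivial representative, and acting by that
     representative appends exactly one syllable. *)
  have t1 : tau j g != 1 by apply/eqP => /tau_eq1 e; apply: (gP (alpha j g)).
  have eqx : pact j x (tau j g) = Syl x (tau j g).
    by rewrite pact_open // /push tauK ifN // (alpha_tau_id (tauK g)) pA1.
  exists (Syl x (tau j g)), (~~ j); split=> /=.
  - by rewrite -eqx; apply: Oact.
  - by rewrite nx ox tauK eqxx.
  - by case: (j).
  - by rewrite lx.
move=> /(finite_image len); apply: contra_not infinite_nat => fin.
apply: sub_finite_set fin => n _.
by have [x [j [Ox _ _ <-]]] := steps n; exists x.
Qed.

End Completion.

(** * Words acting on a set with actions of the factors *)

Lemma generated_one (G : groupType) (S : set G) : generated S 1.
Proof. by rewrite /generated /smallest => K [[+ _] _]; rewrite inE. Qed.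

Lemma generated_div (G : groupType) (S : set G) g h :
  generated S g -> generated S h -> generated S (g / h).
Proof.
move=> Sg Sh K [KG SK]; have [_ /(_ g h)] := KG; rewrite !inE => KD.
by apply: KD; [apply: Sg|apply: Sh].
Qed.

Section Factors.
Variables (X1 X2 : choiceType) (R1 : seq (word X1)) (R2 : seq (word X2)).

Definition factor (i : bool) : groupType :=
  if i then (presented R1 : groupType) else (presented R2 : groupType).

Definition side (a : letter (X1 + X2)) : bool := if a.1 is inl _ then true else false.

Definition elt (a : letter (X1 + X2)) : factor (side a) :=
  match a with
  | (inl x, b) => ev R1 [:: (x, b)]
  | (inr x, b) => ev R2 [:: (x, b)]
  end.

Lemma ev_cons (X : choiceType) (R : seq (word X)) a w :
  ev R (a :: w) = ev R [:: a] * ev R w.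
Proof. by rewrite -cat1s ev_cat. Qed.

Variables (A : groupType) (Y : seq A).
Variables (phi1 : A -> presented R1) (phi2 : A -> presented R2).

Definition amap (i : bool) : A -> factor i :=
  match i with true => phi1 | false => phi2 end.

Let G := amalgam Y phi1 phi2.
Let evG (w : word (X1 + X2)) : G := ev (amalgam_relators Y phi1 phi2) w.

Section WordAction.
Variables (T : Type) (N : T -> bool) (act : forall i, T -> factor i -> T).
Arguments act : clear implicits.
Hypothesis actN : forall i x g, N x -> N (act i x g).
Hypothesis act1 : forall i x, N x -> act i x 1 = x.
Hypothesis actM : forall i x g h, N x -> act i (act i x g) h = act i x (g * h).
Hypothesis act_amap : forall x a, N x ->
  act true x (amap true a) = act false x (amap false a).

Definition wact : T -> word (X1 + X2) -> T :=
  foldl (fun x a => act (side a) x (elt a)).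

Lemma wactN x w : N x -> N (wact x w).
Proof. by elim: w x => //= a w IHw x Nx; apply: IHw; apply: actN. Qed.

Lemma wact_cat x u v : wact x (u ++ v) = wact (wact x u) v.
Proof. exact: foldl_cat. Qed.

Lemma wact_inl x w : N x -> wact x (word_map inl w) = act true x (ev R1 w).
Proof.
elim: w x => [|[a b] w IHw] x Nx /=; first exact/esym/act1.
by rewrite IHw ?actN // (@ev_cons _ R1 (a, b)) actM.
Qed.

Lemma wact_inr x w : N x -> wact x (word_map inr w) = act false x (ev R2 w).
Proof.
elim: w x => [|[a b] w IHw] x Nx /=; first exact/esym/act1.
by rewrite IHw ?actN // (@ev_cons _ R2 (a, b)) actM.
Qed.

Lemma ev_letterV (X : choiceType) (R : seq (word X)) a :
  ev R [:: a] * ev R [:: letter_inv a] = 1.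
Proof. by rewrite -ev_cons; apply/evP/pres_cancel. Qed.

Lemma wact_cancel x a : N x -> wact x [:: a; letter_inv a] = x.
Proof.
case: a => [[a|a] b] Nx /=; rewrite actM //.
  by rewrite (ev_letterV R1 (a, b)) act1.
by rewrite (ev_letterV R2 (a, b)) act1.
Qed.

Lemma wact_wordV x w : N x -> wact (wact x w) (word_inv w) = x.
Proof.
elim: w x => //= a w IHw x Nx.
rewrite /word_inv map_cons rev_cons -cats1 wact_cat IHw ?actN //.
exact: wact_cancel.
Qed.

(** The action descends to the amalgam: relators of a factor are trivial in that factor, and the
    amalgamating relators act trivially by [act_amap]. *)
Lemma wact_eq u v x : pres_eq (amalgam_relators Y phi1 phi2) u v -> N x ->
  wact x u = wact x v.
Proof.
move=> uv; elim: {u v}uv x => //.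
- by move=> u v _ IH x Nx; rewrite IH.
- by move=> u v w _ IHuv _ IHvw x Nx; rewrite IHuv // IHvw.
- by move=> u u' v v' _ IHu _ IHv x Nx; rewrite !wact_cat IHu // IHv // wactN.
- by move=> a x; apply: wact_cancel.
- move=> r; rewrite !mem_cat => /or3P[] /mapP[w wR -> {r}] x Nx.
  + rewrite wact_inl //; suff -> : ev R1 w = 1 by rewrite act1.
    exact/evP/pres_rel.
  + rewrite wact_inr //; suff -> : ev R2 w = 1 by rewrite act1.
    exact/evP/pres_rel.
  + rewrite wact_cat wact_inl // ev_repr (act_amap w Nx) /=.
    by have := wact_inr (repr (phi2 w)) Nx; rewrite ev_repr => <-; rewrite wact_wordV.
Qed.

Variables (x0 : T) (hs : seq (word (X1 + X2))).
Hypothesis Nx0 : N x0.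
Hypothesis hs_fix : forall h, h \in hs -> wact x0 h = x0.

(** Since [H] fixes [x0], sending the coset [H g] to [x0 g] is well defined, and it maps the cosets
    onto the orbit. *)
Lemma orbit_le_index :
  range (wact x0) #<= right_cosets (generated [set evG h | h in [set` hs]]).
Proof.
pose gact x (g : G) := wact x (repr g).
have gactE x w : N x -> gact x (evG w) = wact x w.
  by move=> Nx; apply: wact_eq => //; apply/evP/ev_repr.
have gactM x g h : N x -> gact x (g * h) = gact (gact x g) h.
  move=> Nx; have -> : g * h = evG (repr g ++ repr h) by rewrite /evG ev_cat !ev_repr.
  by rewrite gactE // wact_cat.
have gact1 x : N x -> gact x 1 = x by move=> Nx; rewrite [LHS]gactE.
set H := generated _.
have fixH g : H g -> gact x0 g = x0.
  apply: (@smallest_sub _ _ _ [set g | gact x0 g = x0]) => [|_ [h hsh <-]]; last first.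
    by rewrite /= gactE // hs_fix.
  split=> [|g1 g2]; rewrite !inE /= ?gact1 // => e1 e2.
  by rewrite gactM // e1 -{1}e2 -gactM // mulgV gact1.
have H1 : H 1 by apply: generated_one.
pose F (K : set G) := gact x0 (xget 1 K).
suff -> : range (wact x0) = F @` right_cosets H by apply: card_image_le.
have FE g : F [set h * g | h in H] = gact x0 g.
  rewrite /F; have [h Hh <-] : [set h * g | h in H] (xget 1 [set h * g | h in H]).
    by apply: (@xgetPex _ 1); exists g; exists 1; rewrite ?mul1g.
  by rewrite gactM // fixH.
apply/seteqP; split=> [_ [w _ <-]|_ [_ [g _ <-] <-]].
  exists [set h * evG w | h in H]; first by exists (evG w).
  by rewrite FE gactE.
by rewrite FE; exists (repr g).
Qed.

End WordAction.
End Factors.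

Local Close Scope group_scope.

(** * Tables of precovers and the algorithm *)

Lemma card_uniq_seq (T : eqType) (s : seq T) : uniq s -> [set` s] #= `I_(size s).
Proof.
case: s => [|x s]; first by rewrite set_nil II0.
set t := x :: s => ut; rewrite card_eq_le; apply/andP; split.
  apply: card_le_trans (card_image_le (nth x t) _); apply: subset_card_le => y yt.
  have yn : index y t < size t by rewrite index_mem.
  by exists (index y t); rewrite ?nth_index.
apply: card_le_trans (card_image_le (index^~ t) _); apply: subset_card_le => v vn.
by exists (nth x t v); [exact: mem_nth | exact: index_uniq].
Qed.

Section Tables.
Variables (X1 X2 : finType) (R1 : seq (word X1)) (R2 : seq (word X2)).
Variables (A : groupType) (Y : seq A).
Variables (phi1 : A -> presented R1) (phi2 : A -> presented R2).

Notation factor := (@factor X1 X2 R1 R2).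
Notation side := (@side X1 X2).
Notation elt := (@elt X1 X2 R1 R2).

Variable e : forall i, seq (factor i).
Arguments e : clear implicits.
Hypothesis eP : forall i (g : factor i), g \in e i.

(** Rows of the two factors are interleaved by parity; position [width], beyond all the elements, is
    kept for the domain. *)
Definition width := maxn (size (e true)) (size (e false)).
Definition row (i : bool) j := j.*2 + i.
Definition elt_row i (g : factor i) := row i (index g (e i)).
Definition dom_row i := row i width.
Definition rows := width.+1.*2.

Lemma odd_row i j : odd (row i j) = i.
Proof. by rewrite /row oddD odd_double oddb. Qed.
Lemma half_row i j : (row i j)./2 = j.
Proof. by rewrite /row addnC half_bit_double. Qed.
Lemma row_lt i j : j <= width -> row i j < rows.
Proof.
move=> jw; rewrite /row /rows doubleS ltnS -addn1 leq_add ?leq_double //.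
by case: i.
Qed.
Lemma index_lt_width i g : index g (e i) < width.
Proof.
have : index g (e i) < size (e i) by rewrite index_mem eP.
by move=> /leq_trans; apply; rewrite /width leq_max; case: (i); rewrite leqnn ?orbT.
Qed.
Lemma elt_row_lt i g : @elt_row i g < rows.
Proof. exact/row_lt/ltnW/index_lt_width. Qed.
Lemma dom_row_lt i : dom_row i < rows.
Proof. exact: row_lt. Qed.

(** What a program has to know about the letters enters it as a constant list indexed by letter
    codes. *)
Definition letter_table (F : letter (X1 + X2) -> nat) : seq nat :=
  [seq if [pick a | code_letter a == l] is Some a then F a else 0
     | l <- iota 0 (#|{: X1 + X2}|.*2)].

Lemma code_letter_inj (X : finType) : injective (@code_letter X).
Proof.
move=> [x b] [y d] /= e1.
have : odd (code_letter (x, b)) = odd (code_letter (y, d)) by rewrite e1.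
have : (code_letter (x, b))./2 = (code_letter (y, d))./2 by rewrite e1.
rewrite /code_letter /= ![_.*2 + _]addnC !half_bit_double !oddD !odd_double !addbF !oddb.
by move=> /val_inj/enum_rank_inj -> ->.
Qed.

Lemma letter_tableE F a : nth 0 (letter_table F) (code_letter a) = F a.
Proof.
have lt : code_letter a < #|{: X1 + X2}|.*2.
  apply: (@leq_trans (enum_rank a.1).+1.*2); last by rewrite leq_double.
  by rewrite doubleS /code_letter; case: (a.2); rewrite ?addn0 ?addn1.
rewrite (nth_map 0) ?size_iota // nth_iota // add0n.
by case: pickP => [b /eqP/code_letter_inj -> //|/(_ a)]; rewrite eqxx.
Qed.

(* The code [c] of a partial action on the points [v < n] lists in base
   [n.+1] the values [tab n c k v] for all rows [k] and all [v <= n]: the row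
   of an element [g] of a factor is [v |-> v g], and the row [dom_row i]
   is the indicator function of the set where the factor [i] acts. *)
Definition tab n c k v := digit n.+1 (k * n.+1 + v) c.
Definition dom n c i v := (v < n) && (tab n c (dom_row i) v != 0).

Definition acts n c v i :=
  (tab n c (elt_row (1%g : factor i)) v == v) &&
  all (fun g => dom n c i (tab n c (elt_row g) v) &&
    all (fun h => tab n c (elt_row h) (tab n c (elt_row g) v) ==
                  tab n c (elt_row (g * h)%g) v) (e i)) (e i).

(** A classical test is harmless here and in [nonsurjective]: both depend on the fixed data only and
    are constants of the program. *)
Definition amalgamated : seq (factor true * factor false) :=
  [seq p <- [seq (g, h) | g <- e true, h <- e false]
     | `[< exists a, p = (phi1 a, phi2 a) >] ].

Definition precover n c := all (fun v =>
  [&& dom n c true v || dom n c false v,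
      all (fun i => dom n c i v ==> acts n c v i) [:: true; false] &
      (dom n c true v && dom n c false v) ==>
      all (fun p => tab n c (elt_row p.1) v == tab n c (elt_row p.2) v) amalgamated])
  (iota 0 n).

Definition closed_subset n c d := all (fun v => (digit 2 v d != 0) ==>
  all (fun i => dom n c i v ==>
    all (fun g => digit 2 (tab n c (elt_row g) v) d != 0) (e i)) [:: true; false])
  (iota 0 n).

(* [d] ranges over the codes of all subsets of the points. *)
Definition connected n c := all (fun d =>
  (digit 2 0 d != 0) && closed_subset n c d ==>
  all (fun v => digit 2 v d != 0) (iota 0 n)) (iota 0 (2 ^ n)).

(* The value [n], which is not a point, records that reading has failed. *)
Definition step n c v l :=
  if (v < n) && (tab n c (nth 0 (letter_table (fun a => dom_row (side a))) l) v != 0)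
  then tab n c (nth 0 (letter_table (fun a => elt_row (elt a))) l) v else n.

(** The accumulator drops to 0 for good at the first word that does not lead from the base point 0
    back to it. For [0 < n] the failure value [n] is not 0. *)
Definition reads n c hc := foldl_code
  (fun x w => if foldl_code (step n c) 0 w == 0 then x else 0) 1 hc.

Definition based_precover n c hc :=
  [&& 0 < n, precover n c, connected n c & reads n c hc == 1].

Definition full n c := all (fun v => dom n c true v && dom n c false v) (iota 0 n).

(** A table has [rows] rows of [n.+1] digits in base [n.+1]. *)
Definition codes n := n.+1 ^ (rows * n.+1).
Definition has_nonfull n hc :=
  has (fun c => based_precover n c hc && ~~ full n c) (iota 0 (codes n)).
Definition has_full n hc :=
  has (fun c => based_precover n c hc && full n c) (iota 0 (codes n)).

Definition nonsurjective :=
  `[< (exists g, forall a, phi1 a <> g) /\ (exists g, forall a, phi2 a <> g) >].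
(** There are at most [hc.+1] prefixes to read, counting the empty one separately; each coset
    reached is moved by all listed elements of both factors, and [H] is put in front. *)
Definition size_bound hc := (hc.+1 * (size (e true) + size (e false))).+1.
(** The maximum is found as the least [m] that no full precover in the range exceeds. *)
Definition max_full hc :=
  find (fun m => ~~ has (fun n => (m < n) && has_full n hc) (iota 0 (size_bound hc).+1))
    (iota 0 (size_bound hc)).
Definition index_code hc :=
  if nonsurjective && has (fun n => has_nonfull n hc) (iota 0 (size_bound hc).+1) then 0
  else max_full hc.

(** * Recursiveness of the search *)

Section Recursive.
Variable m : nat.
Implicit Types N C K V W : (nat -> nat) -> nat.

Lemma recursive_tab N C K V : recursive m N -> recursive m C -> recursive m K ->
  recursive m V -> recursive m (fun r => tab (N r) (C r) (K r) (V r)).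
Proof.
move=> rN rC rK rV; apply: recursive_digit => //; first exact: recursive_succ.
by apply: recursive_add => //; apply: recursive_mul => //; apply: recursive_succ.
Qed.

Lemma recursive_neq0 F : recursive m F -> recursive m (fun r => F r != 0).
Proof. by move=> rF; apply: recursive_negb; apply: recursive_eq0. Qed.

Lemma recursive_dom N C V i : recursive m N -> recursive m C -> recursive m V ->
  recursive m (fun r => dom (N r) (C r) i (V r)).
Proof.
move=> rN rC rV; apply: recursive_andb.
  by apply: recursive_leq => //; apply: recursive_succ.
apply: recursive_neq0; apply: recursive_tab => //; exact: recursive_const.
Qed.

Lemma recursive_acts N C V i : recursive m N -> recursive m C -> recursive m V ->
  recursive m (fun r => acts (N r) (C r) (V r) i).
Proof.
move=> rN rC rV.
have rt g : recursive m (fun r => tab (N r) (C r) (@elt_row i g) (V r)).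
  by apply: recursive_tab => //; exact: recursive_const.
apply: recursive_andb; first exact: recursive_eqn.
apply: recursive_all => g; apply: recursive_andb; first exact: recursive_dom.
apply: recursive_all => h; apply: recursive_eqn => //.
by apply: recursive_tab => //; exact: recursive_const.
Qed.
End Recursive.

Lemma recursive_precover m N C : recursive m N -> recursive m C ->
  recursive m (fun r => precover (N r) (C r)).
Proof.
move=> rN rC; apply: (recursive_all_iota (P := fun v r =>
  [&& dom (N r) (C r) true v || dom (N r) (C r) false v,
      all (fun i => dom (N r) (C r) i v ==> acts (N r) (C r) v i) [:: true; false] &
      (dom (N r) (C r) true v && dom (N r) (C r) false v) ==>
      all (fun p => tab (N r) (C r) (elt_row p.1) v == tab (N r) (C r) (elt_row p.2) v)
        amalgamated])) => //.
have {}rN := recursive_shift rN; have {}rC := recursive_shift rC.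
have rV : recursive m.+1 (fun r => r 0) by exact: recursive_var.
have rD i := recursive_dom i rN rC rV.
apply: recursive_andb; first exact: recursive_orb.
apply: recursive_andb.
  apply: recursive_all => i; apply: recursive_implyb => //.
  exact: recursive_acts.
apply: recursive_implyb; first exact: recursive_andb.
apply: recursive_all => p.
by apply: recursive_eqn; apply: recursive_tab => //; exact: recursive_const.
Qed.

Lemma recursive_closed_subset m N C S : recursive m N -> recursive m C ->
  recursive m S -> recursive m (fun r => closed_subset (N r) (C r) (S r)).
Proof.
move=> rN rC rS; apply: (recursive_all_iota (P := fun v r => (digit 2 v (S r) != 0) ==>
  all (fun i => dom (N r) (C r) i v ==>
    all (fun g => digit 2 (tab (N r) (C r) (elt_row g) v) (S r) != 0) (e i))
      [:: true; false])) => //.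
have {}rN := recursive_shift rN; have {}rC := recursive_shift rC.
have {}rS := recursive_shift rS.
have rV : recursive m.+1 (fun r => r 0) by exact: recursive_var.
apply: recursive_implyb.
  by apply: recursive_neq0; apply: recursive_digit => //; exact: recursive_const.
apply: recursive_all => i; apply: recursive_implyb; first exact: recursive_dom.
apply: recursive_all => g; apply: recursive_neq0.
apply: recursive_digit => //; first exact: recursive_const.
by apply: recursive_tab => //; exact: recursive_const.
Qed.

Lemma recursive_connected m N C : recursive m N -> recursive m C ->
  recursive m (fun r => connected (N r) (C r)).
Proof.
move=> rN rC; apply: (recursive_all_iota (P := fun d r =>
  (digit 2 0 d != 0) && closed_subset (N r) (C r) d ==>
  all (fun v => digit 2 v d != 0) (iota 0 (N r)))).
  by apply: recursive_exp => //; exact: recursive_const.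
have {}rN := recursive_shift rN; have {}rC := recursive_shift rC.
have rD : recursive m.+1 (fun r => r 0) by exact: recursive_var.
apply: recursive_implyb; first apply: recursive_andb.
- by apply: recursive_neq0; apply: recursive_digit => //; exact: recursive_const.
- exact: recursive_closed_subset.
- apply: (recursive_all_iota (P := fun v r => digit 2 v (r 0) != 0)) => //.
  apply: recursive_neq0; apply: recursive_digit; try exact: recursive_const.
  + exact: recursive_var.
  + exact: recursive_var.
Qed.

Lemma recursive_reads m N C W : recursive m N -> recursive m C -> recursive m W ->
  recursive m (fun r => reads (N r) (C r) (W r)).
Proof.
move=> rN rC rW; apply: (recursive_foldl_code (S := fun x w r =>
  if foldl_code (step (N r) (C r)) 0 w == 0 then x else 0)) => //.
  exact: recursive_const.
have {}rN := recursive_shift (recursive_shift rN).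
have {}rC := recursive_shift (recursive_shift rC).
apply: recursive_if; [apply: recursive_eq0 | exact: recursive_var | exact: recursive_const].
apply: (recursive_foldl_code (S := fun v l r =>
  step (N (fun i => r i.+2)) (C (fun i => r i.+2)) v l)).
- exact: recursive_var.
- exact: recursive_const.
have {}rN := recursive_shift (recursive_shift rN).
have {}rC := recursive_shift (recursive_shift rC).
have rV : recursive m.+4 (fun r => r 0) by exact: recursive_var.
have rL T : recursive m.+4 (fun r => nth 0 T (r 1)).
  by apply: recursive_lookup; exact: recursive_var.
apply: recursive_if => //.
  apply: recursive_andb; last by apply: recursive_neq0; apply: recursive_tab.
  by apply: recursive_leq => //; apply: recursive_succ.
exact: recursive_tab.
Qed.

Lemma recursive_based_precover m N C W :
  recursive m N -> recursive m C -> recursive m W ->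
  recursive m (fun r => based_precover (N r) (C r) (W r)).
Proof.
move=> rN rC rW; apply: recursive_andb.
  by apply: recursive_leq => //; apply: recursive_const.
apply: recursive_andb; first exact: recursive_precover.
apply: recursive_andb; first exact: recursive_connected.
by apply: recursive_eqn; [exact: recursive_reads | exact: recursive_const].
Qed.

Lemma recursive_full m N C : recursive m N -> recursive m C ->
  recursive m (fun r => full (N r) (C r)).
Proof.
move=> rN rC; apply: (recursive_all_iota (P := fun v r =>
  dom (N r) (C r) true v && dom (N r) (C r) false v)) => //.
by apply: recursive_andb; apply: recursive_dom; rec_leaf.
Qed.

Lemma recursive_codes m N : recursive m N -> recursive m (fun r => codes (N r)).
Proof.
move=> rN; apply: recursive_exp; first exact: recursive_succ.
by apply: recursive_mul; [exact: recursive_const | exact: recursive_succ].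
Qed.

Lemma recursive_has_nonfull m N W : recursive m N -> recursive m W ->
  recursive m (fun r => has_nonfull (N r) (W r)).
Proof.
move=> rN rW; apply: (recursive_has_iota (P := fun c r =>
  based_precover (N r) c (W r) && ~~ full (N r) c)); first exact: recursive_codes.
apply: recursive_andb; first by apply: recursive_based_precover; rec_leaf.
by apply: recursive_negb; apply: recursive_full; rec_leaf.
Qed.

Lemma recursive_has_full m N W : recursive m N -> recursive m W ->
  recursive m (fun r => has_full (N r) (W r)).
Proof.
move=> rN rW; apply: (recursive_has_iota (P := fun c r =>
  based_precover (N r) c (W r) && full (N r) c)); first exact: recursive_codes.
apply: recursive_andb; first by apply: recursive_based_precover; rec_leaf.
by apply: recursive_full; rec_leaf.
Qed.

Lemma recursive_index_code : recursive 1 (fun r => index_code (r 0)).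
Proof.
have rB m W : recursive m W -> recursive m (fun r => size_bound (W r)).
  move=> rW; apply: recursive_succ; apply: recursive_mul; last exact: recursive_const.
  exact: recursive_succ.
have rW : recursive 1 (fun r => r 0) by exact: recursive_var.
have rb := recursive_succ (rB _ _ rW).
apply: recursive_if; last 1 first.
- apply: (recursive_find_iota (P := fun m r =>
    ~~ has (fun n => (m < n) && has_full n (r 0)) (iota 0 (size_bound (r 0)).+1))).
    exact: rB.
  apply: recursive_negb; apply: (recursive_has_iota (P := fun n r =>
    (r 0 < n) && has_full n (r 1))).
    by apply: recursive_succ; apply: rB; exact: recursive_var.
  apply: recursive_andb; last by apply: recursive_has_full; exact: recursive_var.
  by apply: recursive_leq; [apply: recursive_succ|]; exact: recursive_var.
- apply: recursive_andb; first exact: recursive_const.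
  apply: (recursive_has_iota (P := fun n r => has_nonfull n (r 0))) => //.
  by apply: recursive_has_nonfull; exact: recursive_var.
- exact: recursive_const.
Qed.

(** * Precovers bound the index from below *)

Hypothesis phi1M : {morph phi1 : x y / (x * y)%g}.
Hypothesis phi2M : {morph phi2 : x y / (x * y)%g}.
Hypothesis phi1_inj : injective phi1.
Hypothesis phi2_inj : injective phi2.

Lemma amapM i : {morph amap phi1 phi2 i : x y / (x * y)%g}.
Proof. by case: i. Qed.
Lemma amap_inj i : injective (amap phi1 phi2 i).
Proof. by case: i. Qed.

Let G := amalgam Y phi1 phi2.
Let evG (w : word (X1 + X2)) : G := ev (amalgam_relators Y phi1 phi2) w.

Lemma foldl_reads n c hs :
  (reads n c (code_words hs) == 1) =
  all (fun h => foldl (step n c) 0 (map (@code_letter (X1 + X2)%type) h) == 0) hs.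
Proof.
rewrite /reads /code_words foldl_codeE.
have all0 s : foldl (fun x w => if foldl_code (step n c) 0 w == 0 then x else 0) 0 s = 0.
  by elim: s => //= w s IHs; case: ifP.
elim: hs => //= h hs IHhs; rewrite /code_word foldl_codeE.
by case: ifP => // _; rewrite all0.
Qed.

Section Soundness.
Variables (n c : nat) (hs : seq (word (X1 + X2))).
Hypothesis bp : based_precover n c (code_words hs).

Let D := dom n c.
Let op i v (g : factor i) := tab n c (elt_row g) v.
Let pt := nform factor nat.
Let act i (x : pt) (g : factor i) : pt := pact amapM amap_inj D (@op) x g.
Let N : pt -> bool := normal amapM amap_inj D.

Let n_gt0 : 0 < n. Proof. by case/and4P: bp. Qed.

Let precoverP v : v < n ->
  [/\ D true v || D false v, forall i, D i v -> acts n c v i &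
      D true v -> D false v -> forall p, p \in amalgamated ->
      tab n c (elt_row p.1) v = tab n c (elt_row p.2) v].
Proof.
move=> vn; have /and4P[_ /allP/(_ v)] := bp; rewrite mem_iota vn => /(_ isT).
case/and3P=> DD /= /and3P[at_ af _] ag _ _; split=> //.
  by case=> Dv; [move: at_ | move: af]; rewrite -/(D _ _) Dv.
by move=> Dt Df p pa; move: ag; rewrite -!/(D _ _) Dt Df => /allP/(_ _ pa)/eqP.
Qed.

Let D_lt i v : D i v -> v < n. Proof. by case/andP. Qed.

Let op1 i v : D i v -> op v (1%g : factor i) = v.
Proof. by move=> Dv; have [_ /(_ i Dv)/andP[/eqP]] := precoverP (D_lt Dv). Qed.

Let Dop i v g : D i v -> D i (op v (g : factor i)).
Proof.
move=> Dv; have [_ /(_ i Dv)/andP[_ /allP/(_ g)]] := precoverP (D_lt Dv).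
by rewrite eP => /(_ isT)/andP[].
Qed.

Let opM i v g h : D i v -> op (op v g) h = op v (g * h : factor i)%g.
Proof.
move=> Dv; have [_ /(_ i Dv)/andP[_ /allP/(_ g)]] := precoverP (D_lt Dv).
by rewrite eP => /(_ isT)/andP[_ /allP/(_ h)]; rewrite eP => /(_ isT)/eqP.
Qed.

Let op_amap v a : D true v -> D false v ->
  op v (amap phi1 phi2 true a) = op v (amap phi1 phi2 false a).
Proof.
move=> Dt Df; have [_ _ /(_ Dt Df (phi1 a, phi2 a))] := precoverP (D_lt Dt).
apply; rewrite mem_filter; apply/andP; split; first by apply/asboolP; exists a.
by apply/allpairsP; exists (phi1 a, phi2 a); rewrite !eP.
Qed.

Let actN i x g : N x -> N (@act i x g).
Proof. exact: (normal_pact op1 opM Dop op_amap g). Qed.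
Let act1 i x : N x -> @act i x 1%g = x.
Proof. exact: (pact1 op1 op_amap). Qed.
Let actM i x g h : N x -> act (@act i x g) h = act x (g * h)%g.
Proof. exact: (pactM op1 opM Dop op_amap g h). Qed.
Let act_amap x a : N x ->
  act x (amap phi1 phi2 true a) = act x (amap phi1 phi2 false a).
Proof. by move=> Nx; rewrite /act !(pact_phi op_amap). Qed.

Let base v : pt := Base factor v.

Let N_base v : v < n -> N (base v).
Proof. by move=> /precoverP[]. Qed.

(** As long as reading does not fail, the letters move base points of the completion as the table
    prescribes. *)
Let run_lt v w : foldl (step n c) v (map (@code_letter (X1 + X2)%type) w) < n ->
  wact act (base v) w = base (foldl (step n c) v (map (@code_letter (X1 + X2)%type) w)).
Proof.
elim: w v => //= a w IHw v.
(* The failure value is absorbing, so a run ending below [n] has never failed. *)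
have stepn s : foldl (step n c) n s = n.
  by elim: s => //= l s IHs; rewrite /step ltnn.
rewrite /step !letter_tableE; case: ifP => [Dv lt|_]; last by rewrite stepn ltnn.
rewrite -IHw //; congr foldl; exact: pact_base.
Qed.

Let orbit := range (wact act (base 0)).

Let orbit_act j x g : orbit x -> orbit (@act j x g).
Proof.
move=> [w _ <-]; have Nw : N (wact act (base 0) w).
  by apply: (wactN actN); apply: N_base.
case: j g => g.
  exists (w ++ word_map inl (repr g)) => //.
  by rewrite wact_cat (wact_inl actN act1 actM) // ev_repr.
exists (w ++ word_map inr (repr g)) => //.
by rewrite wact_cat (wact_inr actN act1 actM) // ev_repr.
Qed.

Let orbit_base v : v < n -> orbit (base v).
Proof.
(* The points lying in the orbit form a closed subset containing 0; its code is among those tested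
   by [connected]. *)
have [] := @digitsP 2 n (fun v => `[< orbit (base v) >]); first by move=> i _; case: asbool.
move=> d d2 dP; have /and4P[_ _ /allP/(_ d)] := bp.
rewrite mem_iota d2 => /(_ isT) /implyP + _.
have O0 : orbit (base 0) by exists [::].
rewrite dP // eqb0 negbK asboolT // => closed vn.
have /allP/(_ v) : all (fun v => digit 2 v d != 0) (iota 0 n).
  apply: closed; apply/allP => u; rewrite mem_iota => un.
  apply/implyP; rewrite dP // eqb0 negbK => /asboolP Ou.
  apply/allP => i _; apply/implyP => Du; apply/allP => g _.
  rewrite dP ?eqb0 ?negbK; last exact: D_lt (Dop g Du).
  apply/asboolP; have <- : act (base u) g = base (op u g) by exact: pact_base.
  exact: orbit_act.
rewrite mem_iota vn => /(_ isT); rewrite dP // eqb0 negbK.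
by move/asboolP.
Qed.

Let H := generated [set evG h | h in [set` hs]].

Let orbit_index : orbit #<= right_cosets H.
Proof.
apply: (orbit_le_index Y actN act1 actM act_amap); first exact: N_base.
move=> h hsh; have /and4P[_ _ _] := bp.
rewrite foldl_reads => /allP/(_ h hsh)/eqP h0.
by rewrite run_lt h0.
Qed.

Lemma precover_le_index : `I_n #<= right_cosets H.
Proof.
apply: card_le_trans orbit_index.
pose p (x : pt) := if x is Base v then v else 0.
apply: card_le_trans (card_image_le p orbit); apply: subset_card_le => v vn.
by exists (base v) => //; apply: orbit_base.
Qed.

Lemma nonfull_infinite_index : nonsurjective -> ~~ full n c ->
  infinite_set (right_cosets H).
Proof.
move=> /asboolP [ns1 ns2] /allPn[v]; rewrite mem_iota => /= vn nf fin.
have [i nD] : exists i, ~~ D i v.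
  by move: nf; rewrite negb_and => /orP[]; [exists true|exists false].
have ns j : exists g, forall a, amap phi1 phi2 j a <> g by case: j.
have := infinite_orbit (phiM := amapM) (phi_inj := amap_inj) op1 op_amap (i := i) ns
  (N_base vn) nD (orbit_base vn) orbit_act.
by apply; apply: card_le_finite orbit_index fin.
Qed.

End Soundness.

(** * Precovers made of cosets *)

Hypothesis genA : generated [set` Y] = [set: A].

(** The canonical homomorphism of a factor to the amalgam. *)
Definition into i : factor i -> G :=
  match i return factor i -> G with
  | true => fun g => evG (word_map inl (repr g))
  | false => fun g => evG (word_map inr (repr g))
  end.

Lemma pres_eq_map (X X' : choiceType) (f : X -> X') (R : seq (word X)) R' u v :
  (forall r, r \in R -> word_map f r \in R') ->
  pres_eq R u v -> pres_eq R' (word_map f u) (word_map f v).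
Proof.
move=> fR; elim=> {u v} [w|u v _|u v w _ uv _|u u' v v' _ uu _ vv|a|r rR].
- exact: pres_refl.
- exact: pres_sym.
- exact: pres_trans uv.
- by rewrite /word_map !map_cat; apply: pres_cat.
- exact: (pres_cancel R' (f a.1, a.2)).
- exact/pres_rel/fR.
Qed.

Lemma into_inl w : into (ev R1 w : factor true) = evG (word_map inl w).
Proof.
apply/evP; apply: (@pres_eq_map _ _ _ R1) => [r rR|].
  by rewrite mem_cat map_f.
by apply/evP; rewrite ev_repr.
Qed.

Lemma into_inr w : into (ev R2 w : factor false) = evG (word_map inr w).
Proof.
apply/evP; apply: (@pres_eq_map _ _ _ R2) => [r rR|].
  by rewrite !mem_cat map_f ?orbT.
by apply/evP; rewrite ev_repr.
Qed.

Lemma intoM i : {morph @into i : g h / (g * h)%g}.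
Proof.
case: i => g h; rewrite -[g]ev_repr -[h]ev_repr.
  have -> : (ev R1 (repr g) * ev R1 (repr h) = ev R1 (repr g ++ repr h))%g.
    by rewrite ev_cat.
  by rewrite !into_inl /word_map map_cat /evG ev_cat.
have -> : (ev R2 (repr g) * ev R2 (repr h) = ev R2 (repr g ++ repr h))%g.
  by rewrite ev_cat.
by rewrite !into_inr /word_map map_cat /evG ev_cat.
Qed.

(** Relators are imposed for [Y] only, but the elements at which two homomorphisms agree form a
    subgroup, and [Y] generates [A]. *)
Lemma into_amap a : into (amap phi1 phi2 true a) = into (amap phi1 phi2 false a).
Proof.
pose f i a := into (amap phi1 phi2 i a).
have fM i : {morph f i : x y / (x * y)%g} by move=> x y; rewrite /f amapM intoM.
suff : generated [set` Y] `<=` [set a | f true a = f false a].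
  by rewrite genA => /(_ a I).
apply: smallest_sub => [|y yY].
  split=> [|x y]; rewrite !inE; first by rewrite /mkset !(morph_one (fM _)).
  by rewrite /mkset => fx fy; rewrite !fM !(morph_inv (fM _)) fx fy.
have : evG (word_map inl (repr (phi1 y)) ++ word_inv (word_map inr (repr (phi2 y)))) = 1%g.
  by apply/evP/pres_rel; rewrite !mem_cat; apply/or3P/Or33/mapP; exists y.
rewrite /evG ev_cat => e1; rewrite /f /=.
apply: (mulIg (evG (word_inv (word_map inr (repr (phi2 y)))))).
rewrite [LHS]e1; apply/esym.
by transitivity (evG (word_map inr (repr (phi2 y)) ++ word_inv (word_map inr (repr (phi2 y)))));
  [rewrite /evG ev_cat | apply/evP/pres_mulwV].
Qed.

Lemma evG_nil : evG [::] = 1%g.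
Proof. by []. Qed.

Lemma evG_cons a w : evG (a :: w) = (into (elt a) * evG w)%g.
Proof.
rewrite -cat1s /evG ev_cat; congr (_ * _)%g.
by case: a => [[x|x] b]; rewrite /elt ?into_inl ?into_inr.
Qed.

Lemma evG_cat u v : evG (u ++ v) = (evG u * evG v)%g.
Proof. exact: ev_cat. Qed.

Lemma evG_rcons u a : evG (rcons u a) = (evG u * into (elt a))%g.
Proof. by rewrite -cats1 evG_cat evG_cons evG_nil mulg1. Qed.

Definition translate (K : set G) (g : G) : set G := [set (k * g)%g | k in K].

Lemma translateM K g h : translate (translate K g) h = translate K (g * h)%g.
Proof.
apply/seteqP; split=> [_ [_ [k Kk <-] <-]|_ [k Kk <-]].
  by exists k => //; rewrite mulgA.
by exists (k * g)%g; [exists k | rewrite mulgA].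
Qed.

Lemma translate1 K : translate K 1%g = K.
Proof.
apply/seteqP; split=> [_ [k Kk <-]|k Kk]; first by rewrite mulg1.
by exists k; rewrite ?mulg1.
Qed.

Section Cosets.
Variable hs : seq (word (X1 + X2)).
Let H : set G := generated [set evG h | h in [set` hs]].

Lemma translate_id g : H g -> translate H g = H.
Proof.
move=> Hg; have HV h : H h -> H (h^-1)%g.
  by move=> Hh; rewrite -[(h^-1)%g]mul1g; apply: generated_div => //; apply: generated_one.
apply/seteqP; split=> [_ [k Hk <-]|k Hk].
  by rewrite -[g]invgK; apply: generated_div => //; apply: HV.
by exists (k / g)%g; [exact: generated_div | rewrite mulgVK].
Qed.

Lemma translate_gen h : h \in hs -> translate H (evG h) = H.
Proof. by move=> hsh; apply: translate_id; apply: sub_gen_smallest; exists h. Qed.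

(** * Tables of finite lists of cosets *)

Section Encoding.
Variables (vr : seq (set G)) (DD : bool -> set G -> bool).
Let vs := H :: vr.
Let n := size vs.
Hypothesis uvs : uniq vs.
Hypothesis DDvs : forall i K, DD i K -> K \in vs.
Hypothesis DDor : forall K, K \in vs -> DD true K || DD false K.
Hypothesis DDact : forall i K (g : factor i), DD i K -> DD i (translate K (into g)).
Hypothesis DDconn : forall P : set G -> Prop, P H ->
  (forall i K (g : factor i), DD i K -> P K -> P (translate K (into g))) ->
  forall K, K \in vs -> P K.
Hypothesis DDreads : forall h u a v, h \in hs -> h = u ++ a :: v ->
  DD (side a) (translate H (evG u)).

(** The parity of [k] is the factor and its half the element, or [width] for the domain. A translate
    outside [vs] gets the non-point [n], the default of [index]. *)
Let value k v :=
  if k./2 == width then nat_of_bool (DD (odd k) (nth H vs v))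
  else index (translate (nth H vs v) (into (nth (1%g : factor (odd k)) (e (odd k)) k./2))) vs.

(** The laws of a precover hold because both factors act by right translation and [into] is
    compatible with the amalgamation; [H], being first, is the base point 0. *)
Lemma encode : exists c,
  [/\ c < codes n, based_precover n c (code_words hs) &
      full n c = all (fun K => DD true K && DD false K) vs].
Proof.
have valn k v : value k v < n.+1.
  by rewrite /value; case: ifP => _; [case: DD | rewrite ltnS index_size].
have [c cn cP] := @digitsP n.+1 (rows * n.+1) (fun j => value (j %/ n.+1) (j %% n.+1))
  (fun j _ => valn _ _).
have tabE k v : k < rows -> v <= n -> tab n c k v = value k v.
  move=> kr vn; rewrite /tab cP.
    by rewrite divnMDl // modnMDl divn_small ?ltnS // addn0 modn_small.
  by rewrite -ltn_divLR // divnMDl // divn_small ?ltnS // addn0.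
have domE i v : v <= n -> dom n c i v = (v < n) && DD i (nth H vs v).
  move=> vn; rewrite /dom tabE ?dom_row_lt // /value /dom_row half_row odd_row eqxx.
  by rewrite eqb0 negbK.
have eltE i (g : factor i) v : v <= n ->
    tab n c (elt_row g) v = index (translate (nth H vs v) (into g)) vs.
  move=> vn; rewrite tabE ?elt_row_lt // /value /elt_row half_row odd_row.
  by rewrite (ltn_eqF (index_lt_width g)) nth_index ?eP.
have idxP K : K \in vs -> index K vs < n by rewrite index_mem.
have actP i (g : factor i) v : dom n c i v ->
    DD i (translate (nth H vs v) (into g)).
  move=> Dv; have /andP[vn _] := Dv.
  by move: Dv; rewrite domE ?(ltnW vn) // => /andP[_ /DDact].
exists c; split=> //; last first.
  apply/allP/allP => [fu K Kvs|fu v].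
    have := fu (index K vs); rewrite mem_iota idxP // => /(_ isT).
    by rewrite !domE ?(ltnW (idxP _ Kvs)) // idxP // nth_index.
  rewrite mem_iota => vn; have {}vn : v < n by [].
  by rewrite !domE ?(ltnW vn) // vn; apply/fu/mem_nth.
have step_act i (g : factor i) v : dom n c i v ->
    [/\ v < n, translate (nth H vs v) (into g) \in vs &
    tab n c (elt_row g) v = index (translate (nth H vs v) (into g)) vs].
  move=> Dv; have vn : v < n by case/andP: Dv.
  by split; rewrite ?eltE ?(ltnW vn) //; apply: DDvs (actP _ _ _ Dv).
apply/and4P; split=> //.
- apply/allP => v; rewrite mem_iota => vn; have {}vn : v < n by [].
  have vvs := mem_nth H vn.
  apply/and3P; split.
  + by rewrite !domE ?(ltnW vn) // vn; apply: DDor.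
  + apply/allP => i _; apply/implyP => Dv; apply/andP; split.
      have [_ _ ->] := step_act i 1%g v Dv.
      by rewrite (morph_one (@intoM i)) translate1 index_uniq.
    apply/allP => g _; have [_ gvs ->] := step_act i g v Dv.
    apply/andP; split.
      by rewrite domE ?(ltnW (idxP _ gvs)) // idxP // nth_index //; apply: actP.
    apply/allP => h _; rewrite !eltE ?(ltnW (idxP _ gvs)) ?(ltnW vn) //.
    by rewrite nth_index // translateM intoM.
  + apply/implyP => _; apply/allP => p; rewrite mem_filter => /andP[/asboolP[a ->] _].
    rewrite !eltE ?(ltnW vn) //; apply/eqP; congr (index (translate _ _) _).
    exact: into_amap.
- apply/allP => d _; apply/implyP => /andP[d0 /allP cl].
  apply/allP => v; rewrite mem_iota => vn; have {}vn : v < n by [].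
  rewrite -(index_uniq H vn uvs).
  (* A closed subset containing the base point is an invariant to which the connectedness hypothesis
     applies. *)
  apply: (@DDconn (fun K => digit 2 (index K vs) d != 0)); last exact: mem_nth.
    by rewrite /= eqxx.
  move=> i K g DK dK; have Kvs := DDvs DK.
  have := cl (index K vs); rewrite mem_iota idxP // => /(_ isT)/implyP/(_ dK).
  have DK' : dom n c i (index K vs) by rewrite domE ?(ltnW (idxP _ Kvs)) // idxP // nth_index.
  move=> /allP/(_ i); rewrite DK' => /(_ _)/allP/(_ g); rewrite eP.
  have [_ _ ->] := step_act i g _ DK'; rewrite nth_index //; apply=> //.
  by case: (i); rewrite !inE.
- rewrite foldl_reads; apply/allP => h hsh; apply/eqP.
  (* Induction on the unread suffix: after the prefix [u] the run stands at the coset of [u]. *)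
  have runP u v : h = u ++ v -> foldl (step n c) (index (translate H (evG u)) vs)
      (map (@code_letter (X1 + X2)%type) v) = index (translate H (evG h)) vs.
    elim: v u => [|a v IHv] u hE; first by rewrite hE cats0.
    have DK := DDreads hsh hE; have Kvs := DDvs DK.
    have DK' : dom n c (side a) (index (translate H (evG u)) vs).
      by rewrite domE ?(ltnW (idxP _ Kvs)) // idxP // nth_index.
    rewrite /= /step !letter_tableE -/(dom _ _ _ _) DK'.
    have [_ _ ->] := step_act _ (elt a) _ DK'; rewrite nth_index // translateM.
    rewrite -evG_rcons.
    by apply: IHv; rewrite cat_rcons.
  have i0 : index H vs = 0 by rewrite /= eqxx.
  by have := runP [::] h erefl; rewrite (translate_gen hsh) evG_nil translate1 i0.
Qed.

End Encoding.

(** * Factor orbits of the visited cosets, and correctness of the search *)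

Section Saturation.

Let prefixes : seq (word (X1 + X2)) :=
  [::] :: flatten [seq [seq take j h | j <- iota 0 (size h).+1] | h <- hs].
Let Q : seq (set G) := [seq translate H (evG p) | p <- prefixes].
Let sat i : seq (set G) := [seq translate K (into g) | K <- Q, g <- e i].
(** [H] is removed here and put in front below, so that it becomes point number 0. *)
Let vr := [seq K <- undup (sat true ++ sat false) | K != H].
Let vs := H :: vr.

Let satP i K : K \in sat i <->
  exists K' (g : factor i), K' \in Q /\ K = translate K' (into g).
Proof.
split=> [/allpairsP[[K' g] [/= QK _ ->]]|[K' [g [QK ->]]]]; first by exists K', g.
by apply/allpairsP; exists (K', g); split=> //=; apply: eP.
Qed.

Let Q_prefix h u v : h \in hs -> h = u ++ v -> translate H (evG u) \in Q.
Proof.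
move=> hsh hE; apply: (map_f (fun p => translate H (evG p)));
rewrite inE; apply/orP; right; apply/flatten_mapP; exists h => //.
apply/mapP; exists (size u); last by rewrite hE take_size_cat.
by rewrite mem_iota add0n ltnS hE size_cat leq0n leq_addr.
Qed.

Let H_Q : H \in Q.
Proof. by rewrite /Q /= evG_nil translate1 inE eqxx. Qed.

Let Q_sat i K : K \in Q -> K \in sat i.
Proof.
move=> QK; apply/satP; exists K, 1%g; split=> //.
by rewrite (morph_one (@intoM i)) translate1.
Qed.

Let mem_vs K : (K \in vs) = (K \in sat true) || (K \in sat false).
Proof.
rewrite inE mem_filter mem_undup mem_cat; case: eqP => [->|//].
by rewrite (Q_sat true H_Q).
Qed.

Let sat_vs i K : K \in sat i -> K \in vs.
Proof. by rewrite mem_vs; case: i => ->; rewrite ?orbT. Qed.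

Let uniq_vs : uniq vs.
Proof. by rewrite /= filter_uniq ?undup_uniq // mem_filter eqxx. Qed.

Let size_vs : size vs <= size_bound (code_words hs).
Proof.
rewrite /size_bound [size vs]/= ltnS size_filter (leq_trans (count_size _ _)) //.
rewrite (leq_trans (size_undup _)) // size_cat !size_allpairs -mulnDr leq_mul2r.
apply/orP; right; rewrite size_map [size prefixes]/= ltnS size_flatten /shape -map_comp.
apply: leq_trans (sumn_code _); rewrite -map_comp.
elim: (hs) => //= h s IHs; apply: leq_add => //.
by rewrite size_map size_iota ltnS (leq_trans _ (size_code _)) ?size_map.
Qed.

Let sat_act i K (g : factor i) : K \in sat i -> translate K (into g) \in sat i.
Proof.
move=> /satP[K' [h [QK ->]]]; apply/satP; exists K', (h * g)%g.
by rewrite translateM intoM.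
Qed.

(** Each visited coset is reached from [H] letter by letter through visited ones, and every other
    listed coset is one factor element further. *)
Let sat_conn (P : set G -> Prop) : P H ->
  (forall i K (g : factor i), K \in sat i -> P K -> P (translate K (into g))) ->
  forall K, K \in vs -> P K.
Proof.
move=> PH Pact.
have PQ K : K \in Q -> P K.
  case/mapP => p; rewrite inE => /orP[/eqP -> ->|]; first by rewrite evG_nil translate1.
  case/flatten_mapP => h hsh /mapP[j _ ->] ->.
  elim: j => [|j IHj]; first by rewrite take0 evG_nil translate1.
  case: (ltnP j (size h)) => jh; last first.
    by move: IHj; rewrite !take_oversize // leqW.
  have [a0 _] : exists a0 : letter (X1 + X2), True by case: (h) jh => // a; exists a.
  rewrite (take_nth a0) // evG_rcons.
  rewrite -translateM; apply: Pact => //; apply: Q_sat.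
  exact: Q_prefix hsh (esym (cat_take_drop j h)).
move=> K; rewrite mem_vs => /orP[] /satP[K' [g [QK ->]]].
  by apply: Pact; [apply: Q_sat | apply: PQ].
by apply: Pact; [apply: Q_sat | apply: PQ].
Qed.

Let vs_coset K : K \in vs -> exists w, K = translate H (evG w).
Proof.
apply: (@sat_conn (fun K => exists w, K = translate H (evG w))).
  by exists [::]; rewrite evG_nil translate1.
move=> i K' g _ [w ->]; rewrite translateM.
by exists (w ++ repr (into g)); rewrite evG_cat /evG ev_repr.
Qed.

Let saturated_precover : exists c,
  [/\ c < codes (size vs), based_precover (size vs) c (code_words hs) &
      full (size vs) c = all (fun K => (K \in sat true) && (K \in sat false)) vs].
Proof.
apply: (encode (DD := fun i K => K \in sat i)) => //.
- by move=> K; rewrite mem_vs.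
- by move=> h u a v hsh hE; apply: Q_sat; apply: Q_prefix hsh hE.
Qed.

(** Once the list holds all cosets, both factors may be given the whole list as domain. *)
Let total_precover : (forall g, translate H g \in vs) -> has_full (size vs) (code_words hs).
Proof.
move=> all_vs.
have vs_act K g : K \in vs -> translate K g \in vs.
  by case/vs_coset=> w ->; rewrite translateM.
have [||||||c [cn bp fu]] := @encode vr (fun _ K => K \in vs) => //.
- by move=> K ->.
- by move=> i K g; apply: vs_act.
- move=> P PH Pact K Kvs; apply: (sat_conn PH) Kvs => i K' g Ki PK.
  by apply: Pact => //; apply: sat_vs Ki.
apply/hasP; exists c; first by rewrite mem_iota.
by rewrite bp fu; apply/allP => K ->.
Qed.

(** If both saturations are the whole list, it is stable under every letter, hence under [G]. *)
Let closed_all : all (fun K => (K \in sat true) && (K \in sat false)) vs ->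
  forall g, translate H g \in vs.
Proof.
move=> /allP fu g; rewrite -[g]ev_repr.
suff: forall K, K \in vs -> translate K (evG (repr g)) \in vs by apply; rewrite inE eqxx.
elim: (repr g) => [|a w IHw] K Kvs; first by rewrite evG_nil translate1.
rewrite evG_cons -translateM; apply: IHw; rewrite mem_vs.
have /andP[Kt Kf] := fu K Kvs.
case: (side a) (elt a) => x; first by rewrite (sat_act _ Kt).
by rewrite (sat_act x Kf) orbT.
Qed.

(** If [A] is all of a factor, the image of that factor lies in the image of the other one, which is
    then all of [G]; a single factor orbit of [H] contains every coset. *)
Let surjective_all : ~~ nonsurjective -> forall g, translate H g \in vs.
Proof.
move=> ns.
have [i onto] : exists i, forall g : factor i, exists a, amap phi1 phi2 i a = g.
  apply: contrapT => no; move/asboolP: ns; apply; split; apply: contrapT => no'.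
    apply: no; exists true => g; apply: contrapT => ng; apply: no'.
    by exists g => a ga; apply: ng; exists a.
  apply: no; exists false => g; apply: contrapT => ng; apply: no'.
  by exists g => a ga; apply: ng; exists a.
have other j (x : factor j) : exists y : factor (~~ i), into x = into y.
  case: i j onto x => [] [] onto x; try by exists x.
    have [a <-] := onto x; exists (amap phi1 phi2 false a); exact: into_amap.
  have [a <-] := onto x; exists (amap phi1 phi2 true a); exact/esym/into_amap.
have into_all w : exists y : factor (~~ i), evG w = into y.
  elim: w => [|b w [y IHw]]; first by exists 1%g; rewrite (morph_one (@intoM _)).
  have [z zE] := other _ (elt b).
  by exists (z * y)%g; rewrite intoM -zE -IHw evG_cons.
move=> g; have [y yE] := into_all (repr g).
have -> : g = into y by rewrite -yE /evG ev_repr.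
by apply: sat_vs; apply: sat_act; apply: Q_sat.
Qed.

Lemma index_codeP : exists k, has_index H k /\ index_code (code_words hs) = code_index k.
Proof.
have cosetsP : (forall g, translate H g \in vs) -> right_cosets H = [set` vs].
  move=> all_vs; apply/seteqP; split=> [_ [g _ <-]|K /vs_coset[w ->]]; first exact: all_vs.
  by exists (evG w).
have [c [cn bp fu]] := saturated_precover.
have bound : size vs < (size_bound (code_words hs)).+1 by rewrite ltnS.
have [fin|inf] := pselect (finite_set (right_cosets H)); last first.
  exists None; split=> //.
  (* A finite list misses some coset, so [A] is proper in both factors and the saturated precover is
     not full: the search meets it and answers 0. *)
  have notall : ~ forall g, translate H g \in vs.
    by move=> /cosetsP e1; apply: inf; rewrite e1; apply: finite_seq.
  have ns : nonsurjective by apply: contrapT => /negP/surjective_all.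
  rewrite /index_code ns ifT //; apply/hasP; exists (size vs); first by rewrite mem_iota.
  apply/hasP; exists c; first by rewrite mem_iota.
  rewrite bp fu; apply/negP => /closed_all; exact: notall.
have nonfull n : nonsurjective -> ~~ has_nonfull n (code_words hs).
  move=> ns; apply/hasPn => d _; apply/negP => /andP[bd nf].
  exact: (nonfull_infinite_index bd ns nf).
have all_vs : forall g, translate H g \in vs.
  (* With [A] proper in both factors, a saturated precover that is not full would make the index
     infinite. *)
  case: (boolP nonsurjective) => [ns|]; last exact: surjective_all.
  apply: closed_all; rewrite -fu; apply: contraT => nf.
  have /hasPn/(_ c) := nonfull (size vs) ns; rewrite mem_iota => /(_ cn).
  by rewrite bp nf.
have card_vs : right_cosets H #= `I_(size vs).
  by rewrite (cosetsP all_vs); apply: card_uniq_seq.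
exists (Some (size vs)); split=> //.
have -> : index_code (code_words hs) = max_full (code_words hs).
  rewrite /index_code; case: ifP => // /andP[ns /hasP[n _]].
  by rewrite (negbTE (nonfull _ ns)).
(* The size of [vs] is itself written as a search over the same range, so only the two predicates
   have to be compared. *)
rewrite /max_full -[RHS](find_geq_iota size_vs); apply: eq_find => m.
apply/idP/idP => [/hasPn/(_ (size vs))|le].
  by rewrite mem_iota => /(_ bound); rewrite total_precover // andbT -leqNgt.
apply/hasPn => n _; apply/negP => /andP[mn /hasP[d _ /andP[bd _]]].
(* A precover with more points than [vs] would exceed the index. *)
have := card_le_trans (precover_le_index bd) (_ : _ #<= `I_(size vs)).
rewrite (card_eq_le _ _) in card_vs; case/andP: card_vs => -> _ /(_ isT).
by rewrite card_le_II leqNgt (leq_ltn_trans le mn).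
Qed.

End Saturation.
End Cosets.

End Tables.

Unset Implicit Arguments.
Set Strict Implicit.

Theorem corollary7p2
  (X1 X2 : finType) (R1 : seq (word X1)) (R2 : seq (word X2))
  (finG1 : finite_set [set: presented R1])
  (finG2 : finite_set [set: presented R2])
  (A : groupType) (Y : seq A) (genA : generated [set` Y] = [set: A])
  (phi1 : {multiplicative A -> presented R1})
  (phi2 : {multiplicative A -> presented R2})
  (inj1 : injective phi1) (inj2 : injective phi2) :
  exists algo : murec 1,
    forall hs : seq (word (X1 + X2)%type),
      let G := amalgam Y phi1 phi2 in
      let H : set G := generated [set ev _ h | h in [set` hs]] in
      exists k : option nat,
        has_index H k /\
        computes algo [tuple code_words hs] (code_index k).
Proof.
have [s1 s1E] := (finite_seqP _).1 finG1.
have [s2 s2E] := (finite_seqP _).1 finG2.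
(* These enumerations of the finite factors supply the constants of the program. *)
pose e i : seq (factor R1 R2 i) :=
  match i return seq (factor R1 R2 i) with true => s1 | false => s2 end.
have eP i (g : factor R1 R2 i) : g \in e i.
  by case: i g => g /=; [have : [set` s1] g by rewrite -s1E
                        |have : [set` s2] g by rewrite -s2E].
have [algo algoP] := recursive_index_code phi1 phi2 e.
exists algo => hs G H.
have [k [Hk indexE]] :=
  index_codeP eP (@gmulfM _ _ phi1) (@gmulfM _ _ phi2) inj1 inj2 genA hs.
exists k; split=> //; rewrite -indexE; exact: algoP.
Qed.
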